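(* Let $n\ge 2$ and let $(W,S)$ be the Coxeter system of type $\widetilde{D}_{n+2}$. The set $\mathrm{I}(\widetilde{D}_{n+2})$ of star irreducible fully commutative elements is the disjoint union $$\mathrm{I}(\widetilde{D}_{n+2})=\mathrm{K}(\widetilde{D}_{n+2})\sqcup \mathrm{CZ}(\widetilde{D}_{n+2})\sqcup \mathrm{CC}(\widetilde{D}_{n+2})$$ of the sets of candy elements, of complete zigzags and of completely commutative elements. If $n$ is odd, then $\mathrm{K}(\widetilde{D}_{n+2})=\emptyset$.
   Context: Type $\widetilde{D}_{n+2}$: generators $S=\{s_0,\dots,s_{n+2}\}$, $m_{s,t}=3$ exactly for the pairs $\{s_0,s_2\}$, $\{s_1,s_2\}$, $\{s_i,s_{i+1}\}$ ($2\le i\le n-1$), $\{s_n,s_{n+1}\}$, $\{s_n,s_{n+2}\}$; all other pairs of distinct generators commute ($m_{s,t}=2$). $\ell$ is the length. An element $w$ is fully commutative (FC) if any two reduced expressions of $w$ are related by commutation relations only; $\mathrm{FC}(\widetilde{D}_{n+2})$ is the set of FC elements. $\mathrm{D_L}(w)=\{s\in S:\ell(sw)<\ell(w)\}$, $\mathrm{D_R}(w)=\{s\in S:\ell(ws)<\ell(w)\}$, and $supp(w)$ is the set of generators occurring in a reduced expression of $w$. Star reducibility: $w\in \mathrm{FC}$ is left (resp. right) star reducible by $s$ with respect to $t$ to $sw$ (resp. $ws$) if $s\in \mathrm{D_L}(w)$ and $t\in \mathrm{D_L}(sw)$ (resp. $s\in \mathrm{D_R}(w)$ and $t\in \mathrm{D_R}(ws)$)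 with $m_{s,t}\ge 3$. $w\in\mathrm{FC}$ is star irreducible if it is neither left nor right star reducible by any $s$ with respect to any $t$; $\mathrm{I}(\widetilde{D}_{n+2})$ is the set of these. $\mathrm{CC}(\widetilde{D}_{n+2})$ is the set of products of pairwise commuting distinct generators (including the identity $e$). Complete zigzags: let $A=s_2s_3\cdots s_ns_{n+1}s_{n+2}$ and $B=s_ns_{n-1}\cdots s_2s_1s_0$. $\mathrm{CZ}(\widetilde{D}_{n+2})$ is the set of FC elements having a reduced expression of the form $s_0s_1(AB)^kA^h$ or $s_{n+2}s_{n+1}(BA)^kB^h$, with $k\ge 0$, $h\in\{0,1\}$, $k+h>0$. Cartier–Foata normal form (CFNF): every FC element $w$ factors uniquely as $w=u_0\cdots u_m$ with each $u_i$ completely commutative, $supp(u_0)=\mathrm{D_L}(w)$, $\ell(w)=\sum_i\ell(u_i)$, and for every $t\in supp(u_{j+1})$ there is $s\in supp(u_j)$ with $m_{s,t}\ge 3$. Candies: for $n$ even, an FC element $w$ with CFNF $w=u_0\cdots u_m$, $m\ge 2$, is a candy if $m$ is even, $supp(u_{2i})=\{s_3,s_5,\dots,s_{n-1}\}\cup\{x_i,y_i\}$ with $x_i\in\{s_0,s_1\}$, $y_i\in\{s_{n+1},s_{n+2}\}$ for $0\le i\le m/2$, with $x_i\ne x_{i+1}$ and $y_i\neq y_{i+1}$ for consecutive indices, and $supp(u_{2i+1})=\{s_2,s_4,\dots,s_n\}$ for $0\le i<m/2$. $\mathrm{K}(\widetilde{D}_{n+2})$ is the set of candies; it is set to be $\emptyset$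 when $n$ is odd. *)

(* Defs.v *)
From Stdlib Require Import Relations.Relation_Operators.
From HB Require Import structures.
From mathcomp Require Import all_boot.
From mathcomp Require Import classical_sets.

Set Implicit Arguments.
Unset Strict Implicit.
Unset Printing Implicit Defensive.

Local Open Scope group_scope.

(* Standard presentation < I | (i j)^(m i j) = 1 >, on words.  Together with
   m i i = 1 it makes every letter an involution, so that the monoid of words
   modulo [cox_equiv] is the Coxeter group.  An entry m i j = 0 would mean "no
   relation" (m = oo); the matrices used below have no such entry. *)
Inductive cox_step (I : Type) (m : I -> I -> nat) : seq I -> seq I -> Prop :=
  CoxStep a b i j :
    cox_step m (a ++ flatten (nseq (m i j) [:: i; j]) ++ b) (a ++ b).

Definition cox_equiv (I : Type) (m : I -> I -> nat) :=
  clos_refl_sym_trans (seq I) (cox_step m).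

(* A Coxeter system (W, S) with Coxeter matrix m, S being indexed by I. *)
Record coxeterSystem (I : finType) (m : I -> I -> nat) := CoxeterSystem {
  cox_group :> groupType;
  cox_gen : I -> cox_group;
  cox_generated : forall w, exists u : seq I, \prod_(i <- u) cox_gen i = w;
  cox_presented : forall u v : seq I,
    \prod_(i <- u) cox_gen i = \prod_(i <- v) cox_gen i <-> cox_equiv m u v
}.

Section Coxeter.
Variables (I : finType) (m : I -> I -> nat) (W : coxeterSystem m).
Implicit Types (w : W) (u v : seq I) (s t : I).

Local Notation gen := (@cox_gen I m W).

Definition wprod u : W := \prod_(i <- u) gen i.

Lemma ex_word_size w :
  exists k, [exists u : k.-tuple I, wprod u == w].
Proof.
have [u uw] := cox_generated w.
by exists (size u); apply/existsP; exists (in_tuple u); apply/eqP.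
Qed.

Definition ell w : nat := ex_minn (ex_word_size w).

Definition reduced_expr u w : Prop := wprod u = w /\ size u = ell w.

Definition supp w : {set I} :=
  [set s | [exists u : (ell w).-tuple I, (wprod u == w) && (s \in u)]].

Definition DL w : {set I} := [set s | ell (gen s * w) < ell w].
Definition DR w : {set I} := [set s | ell (w * gen s) < ell w].

Inductive comm_step : seq I -> seq I -> Prop :=
  CommStep a b s t :
    m s t = 2 -> comm_step (a ++ [:: s; t] ++ b) (a ++ [:: t; s] ++ b).

Definition comm_equiv := clos_refl_sym_trans (seq I) comm_step.

Definition FC : set W := fun w =>
  forall u v, reduced_expr u w -> reduced_expr v w -> comm_equiv u v.

Definition left_star_reducible s t w : Prop :=
  [/\ s \in DL w, t \in DL (gen s * w) & 3 <= m s t].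

Definition right_star_reducible s t w : Prop :=
  [/\ s \in DR w, t \in DR (w * gen s) & 3 <= m s t].

Definition star_irreducible : set W := fun w =>
  FC w /\
  forall s t, ~ left_star_reducible s t w /\ ~ right_star_reducible s t w.

Definition CC : set W := fun w =>
  exists u, [/\ uniq u,
                {in u &, forall s t, commute (gen s) (gen t)} &
                w = wprod u].

Definition is_CFNF (us : seq W) w : Prop :=
  [/\ w = \prod_(x <- us) x,
      forall x, x \in us -> CC x,
      supp (nth 1 us 0) = DL w,
      ell w = (\sum_(x <- us) ell x)%N &
      forall j, j.+1 < size us -> forall t, t \in supp (nth 1 us j.+1) ->
        exists2 s, s \in supp (nth 1 us j) & 3 <= m s t].

End Coxeter.

Local Open Scope nat_scope.

Arguments wprod {I m} W u.
Arguments FC {I m} W.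
Arguments star_irreducible {I m} W.
Arguments CC {I m} W.

Definition Dtilde_edge (n i j : nat) : bool :=
  [|| (i == 0) && (j == 2), (i == 1) && (j == 2),
      (2 <= i <= n.-1) && (j == i.+1),
      (i == n) && (j == n.+1) | (i == n) && (j == n.+2)].

(* The index n is that of D~_(n+2): the generators are s_0, ..., s_(n+2). *)
Definition Dtilde (n : nat) (i j : 'I_n.+3) : nat :=
  if i == j then 1 else if Dtilde_edge n i j || Dtilde_edge n j i then 3 else 2.
Arguments Dtilde : clear implicits.

Section CoxeterDtilde.
Variables (n : nat) (W : coxeterSystem (Dtilde n)).

(* Only applied to indices k <= n + 2, where [inord] does not truncate. *)
Definition Dword (ks : seq nat) : seq 'I_n.+3 := [seq inord k | k <- ks].

Definition zigA : seq 'I_n.+3 := Dword (iota 2 n.+1).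
Definition zigB : seq 'I_n.+3 := Dword (rev (iota 0 n.+1)).

Definition wpow (u : seq 'I_n.+3) (k : nat) := flatten (nseq k u).

Definition CZ : set W := fun w =>
  FC W w /\ exists k h : nat, [/\ h <= 1, 0 < k + h &
    reduced_expr (Dword [:: 0; 1] ++ wpow (zigA ++ zigB) k ++ wpow zigA h) w \/
    reduced_expr (Dword [:: n.+2; n.+1] ++ wpow (zigB ++ zigA) k ++ wpow zigB h)
                 w].

(* [us] is u_0, ..., u_p, so that the p of this definition is the last index
   of the normal form. *)
Definition candies : set W := fun w =>
  [/\ ~~ odd n, FC W w &
    exists (us : seq W) (p : nat) (x y : nat -> 'I_n.+3),
      [/\ size us = p.+1 /\ is_CFNF us w, 2 <= p, ~~ odd p,
          forall i, i <= p./2 ->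
            [/\ val (x i) \in [:: 0; 1], val (y i) \in [:: n.+1; n.+2] &
                supp (nth 1%g us i.*2) =
                [set j : 'I_n.+3 | odd j & 3 <= j <= n.-1] :|: [set x i; y i]] &
          forall i, i < p./2 ->
            [/\ x i != x i.+1, y i != y i.+1 &
                supp (nth 1%g us i.*2.+1) =
                [set j : 'I_n.+3 | ~~ odd j & 2 <= j <= n]]]].

End CoxeterDtilde.

Arguments CZ {n} W.
Arguments candies {n} W.

(* Main.v *)
(* For a fully commutative w everything can be read off a single reduced word u, up to
   commutations: s is a left descent iff no neighbour of s precedes the first s, and w
   is left star irreducible iff u has no adjacent letters s, t such that s is such a
   descent and exactly one neighbour of t precedes the first t.  No exchange property
   is needed.

   The classification is a discharging argument.  Let c_i be the number of occurrences
   of i in u, N_i the number of occurrences of its neighbours, and let delta be the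
   marks of the affine diagram, so that the neighbours of i have total mark 2 delta_i
   and sum_i delta_i (N_i - 2 c_i) = 0.  At least two neighbours of i occur between
   consecutive i's; adding the contributions of both ends of u, and letting every
   initial or final letter receive half a unit from each of its neighbours, one gets an
   inequality at each vertex whose delta-weighted sum is an equality.  So each of them is
   an equality: exactly two neighbours occur between consecutive i's, and either 0 or 1
   of them, none initial, or exactly 2, both initial, precede the first i.  Such a word
   is determined, up to commutations, by its initial pattern and its letter counts.  On
   the diagram of type D~, the possible patterns are those of the zigzags and of the
   candies, and linear recursions then give the letter counts. *)
From Stdlib Require Import Relations.Relation_Operators.
Require Import Defs.
From mathcomp Require Import all_boot all_algebra zify ring.
From mathcomp Require Import classical_sets.

Set Implicit Arguments.
Unset Strict Implicit.
Unset Printing Implicit Defensive.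

Lemma cat_cons_split (T : Type) (u v p q : seq T) x : u ++ v = p ++ x :: q ->
  (exists r, u = p ++ x :: r /\ q = r ++ v) \/ (exists r, p = u ++ r /\ v = r ++ x :: q).
Proof.
elim: u p => [|y u IH] [|z p] /=.
- by move=> ->; right; exists [::].
- by move=> ->; right; exists (z :: p).
- by move=> [-> <-]; left; exists u.
- move=> [-> /IH[[r [-> ->]]|[r [-> ->]]]]; first by left; exists r.
  by right; exists r.
Qed.

(** * Words up to commutations *)

Section Words.
Variables (I : finType) (m : I -> I -> nat).
Implicit Types (a b p q r u v : seq I) (i j s t : I).
Hypothesis m_diag : forall s, m s s = 1.
Hypothesis m_sym : forall s t, m s t = m t s.
Hypothesis m_offdiag : forall s t, s != t -> (m s t == 2) || (m s t == 3).

Definition adj (s t : I) : bool := m s t == 3.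

Lemma adj_def s t : adj s t = (m s t == 3). Proof. by []. Qed.
Lemma adjC s t : adj s t = adj t s. Proof. by rewrite /adj m_sym. Qed.
Lemma adjxx s : adj s s = false. Proof. by rewrite /adj m_diag. Qed.

Lemma adj_neq s t : adj s t -> s != t.
Proof. by apply: contraTneq => ->; rewrite adjxx. Qed.

Lemma nadj_m2 s t : s != t -> ~~ adj s t -> m s t = 2.
Proof. by move=> /m_offdiag; rewrite /adj => /orP[/eqP->|/eqP->]. Qed.

Lemma m2_nadj s t : m s t = 2 -> ~~ adj s t /\ s != t.
Proof.
by rewrite /adj => E; split; [rewrite E|apply: contra_eqN E => /eqP->; rewrite m_diag].
Qed.

Lemma ge3_adj s t : (3 <= m s t) = adj s t.
Proof.
rewrite /adj; have [->|/m_offdiag] := eqVneq s t; first by rewrite m_diag.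
by case/orP => /eqP ->.
Qed.

Lemma comm_equiv_refl u : comm_equiv m u u.
Proof. exact: rst_refl. Qed.

Lemma comm_equiv_sym u v : comm_equiv m u v -> comm_equiv m v u.
Proof. exact: rst_sym. Qed.

Lemma comm_equiv_trans v u w :
  comm_equiv m u v -> comm_equiv m v w -> comm_equiv m u w.
Proof. exact: rst_trans. Qed.

Lemma comm_equiv_invariant (T : Type) (f : seq I -> T) :
  (forall a b s t, m s t = 2 ->
     f (a ++ [:: s; t] ++ b) = f (a ++ [:: t; s] ++ b)) ->
  forall u v, comm_equiv m u v -> f u = f v.
Proof.
move=> fP u v; elim=> // {u v} [_ _ [a b s t st]|u v w _ -> _ //].
exact: fP.
Qed.

Lemma comm_equiv_cat a b u v :
  comm_equiv m u v -> comm_equiv m (a ++ u ++ b) (a ++ v ++ b).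
Proof.
elim=> {u v} [_ _ [c d s t st]|u|u v _|u v w _ IH1 _].
- apply: rst_step; rewrite -!catA !(catA a c); exact: CommStep.
- exact: comm_equiv_refl.
- exact: comm_equiv_sym.
- exact: comm_equiv_trans.
Qed.

Lemma comm_equiv_cons s u v : comm_equiv m u v -> comm_equiv m (s :: u) (s :: v).
Proof. by move/(comm_equiv_cat [:: s] [::]); rewrite /= !cats0. Qed.

Lemma comm_equiv_rev u v : comm_equiv m u v -> comm_equiv m (rev u) (rev v).
Proof.
elim=> {u v} [_ _ [c d s t st]|u|u v _|u v w _ IH1 _].
- rewrite !rev_cat -!catA; apply: rst_step.
  by apply: (@CommStep _ m (rev d) (rev c) t s); rewrite m_sym.
- exact: comm_equiv_refl.
- exact: comm_equiv_sym.
- exact: comm_equiv_trans.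
Qed.

Lemma comm_equiv_perm u v : comm_equiv m u v -> perm_eq u v.
Proof.
move=> uv; apply/permP => a; apply: comm_equiv_invariant u v uv => p q s t _.
by rewrite !count_cat /=; lia.
Qed.

(** * Neighbour counts and first occurrences *)

Definition nbc s u := count (adj s) u.

Lemma nbc_cat s u v : nbc s (u ++ v) = nbc s u + nbc s v.
Proof. exact: count_cat. Qed.

Lemma nbc_rev s u : nbc s (rev u) = nbc s u.
Proof. exact: count_rev. Qed.

Lemma nbc0P s u : reflect {in u, forall t, ~~ adj s t} (nbc s u == 0).
Proof.
rewrite -leqn0 leqNgt -has_count; apply: (iffP hasPn) => H t /H //.
Qed.

Lemma nbc_sum s u : nbc s u = \sum_(t | adj s t) count_mem t u.
Proof.
elim: u => [|x u IH]; first by rewrite big1.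
rewrite /nbc /= -/(nbc s u) IH [RHS]big_split /=; congr (_ + _).
case: (boolP (adj s x)) => sx.
  by rewrite (bigD1 x) //= eqxx big1 // => t /andP[_ /negPf]; rewrite eq_sym => ->.
rewrite big1 // => t st; rewrite (_ : (x == t) = false) //.
by apply: contraNF sx => /eqP->.
Qed.

Lemma comm_equiv_jump s q : s \notin q -> nbc s q = 0 ->
  comm_equiv m (s :: q) (q ++ [:: s]).
Proof.
elim: q => [|t q IH]; first by move=> *; exact: comm_equiv_refl.
rewrite inE negb_or => /andP[st sq] /eqP/nbc0P N.
apply: (@comm_equiv_trans (t :: s :: q)).
  apply: rst_step; apply: (@CommStep _ m [::] q s t); apply: nadj_m2 => //.
  by apply: N; rewrite inE eqxx.
apply: comm_equiv_cons; apply: IH => //; apply/eqP/nbc0P => r rq.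
by apply: N; rewrite inE rq orbT.
Qed.

Lemma comm_equiv_front s p q : s \notin p -> nbc s p = 0 ->
  comm_equiv m (p ++ s :: q) (s :: p ++ q).
Proof.
move=> sp N; apply: comm_equiv_sym.
have := comm_equiv_cat [::] q (comm_equiv_jump sp N).
by rewrite /= -catA.
Qed.

Lemma first_split (s : I) u : s \in u -> exists p q, u = p ++ s :: q /\ s \notin p.
Proof.
case/splitPr=> {}u v; elim: u => [|x u [p [q [E sp]]]]; first by exists [::], v.
have [->|xs] := eqVneq x s; first by exists [::], (u ++ s :: v).
by exists (x :: p), q; rewrite cat_cons E inE eq_sym negb_or xs.
Qed.

Lemma last_split (s : I) u : s \in u -> exists p q, u = p ++ s :: q /\ s \notin q.
Proof.
rewrite -mem_rev => /first_split[p [q [E sp]]]; exists (rev q), (rev p).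
by rewrite mem_rev -cat_rcons -rev_cons -rev_cat -E revK.
Qed.

(** The count stops at the first [s]; for a letter that does not occur it runs over the whole word.
    In both cases it is invariant under commutations. *)
Fixpoint pre s u :=
  if u is t :: u' then if t == s then 0 else adj s t + pre s u' else 0.

Lemma pre_cat s u v :
  pre s (u ++ v) = if s \in u then pre s u else nbc s u + pre s v.
Proof.
elim: u => //= x u IH; rewrite inE eq_sym; case: eqP => //= _.
by rewrite IH; case: ifP => //; rewrite addnA.
Qed.

Lemma pre_first s p q : s \notin p -> pre s (p ++ s :: q) = nbc s p.
Proof. by move=> /negPf sp; rewrite pre_cat sp /= eqxx addn0. Qed.

Lemma comm_equiv_pre s u v : comm_equiv m u v -> pre s u = pre s v.
Proof.
move: u v; apply: comm_equiv_invariant => a b x y.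
case/m2_nadj => xy nxy; rewrite !(pre_cat _ a) /=; case: ifP => // _; congr (_ + _).
have [xs|xs] := eqVneq x s; have [ys|ys] := eqVneq y s => //; last by rewrite addnCA.
- by rewrite -xs (negPf xy).
- by rewrite -ys adjC (negPf xy).
Qed.

(** Otherwise the first [j] would come after this [i], a neighbour of it, and [pre j] would be
    positive. *)
Lemma pre0_before i j p q : j \in p ++ i :: q -> adj i j ->
  pre j (p ++ i :: q) = 0 -> j \in p.
Proof.
move=> ju ij; rewrite pre_cat; case: ifP => //= _.
by rewrite (negPf (adj_neq ij)) adjC ij; lia.
Qed.

(** * Spacing, star irreducibility and pace of words *)

Definition spread u := forall p s q r,
  u = p ++ s :: q ++ s :: r -> s \notin q -> 2 <= nbc s q.

Definition lirr u := forall s t, s \in u -> t \in u ->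
  pre s u = 0 -> pre t u = 1 -> ~~ adj s t.

(* [f i] plays the role of the number of neighbours of [i] read before [u] starts, as if
   an [i] had come before them: a letter may only be read when this count is exactly 2. *)
Definition paced (f : I -> nat) u := forall p i q,
  u = p ++ i :: q -> f i + nbc i p = 2 + 2 * count_mem i p.

Lemma spread_rev u : spread u -> spread (rev u).
Proof.
move=> U p s q r E sq; rewrite -(nbc_rev s); apply: (U (rev r) s _ (rev p)).
  by rewrite -[u]revK E !(rev_cat, rev_cons) -!cats1 -!catA.
by rewrite mem_rev.
Qed.

(** Induction on the length of [p], going back to the previous [i]: each gap between consecutive
    occurrences contributes at least two neighbours, and [pre i u] accounts for those before the
    first. *)
Lemma spread_pace u p i q : spread u -> u = p ++ i :: q ->
  pre i u + 2 * count_mem i p <= nbc i p.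
Proof.
move=> U; have [k] := ubnP (size p).
elim: k p q => // k IH p q; rewrite ltnS => pk E.
have [/last_split[p1 [p2 [Ep ip2]]]|ip] := boolP (i \in p); last first.
  by rewrite E pre_first // (count_memPn ip) muln0 addn0.
have p1k : size p1 < k by move: pk; rewrite Ep size_cat /=; lia.
have E1 : u = p1 ++ i :: p2 ++ i :: q by rewrite E Ep -catA.
have := IH p1 _ p1k E1; have := U _ _ _ _ E1 ip2.
rewrite Ep nbc_cat count_cat /= /nbc /= adjxx (count_memPn ip2) eqxx.
lia.
Qed.

Lemma spread_suffix_pace u p i q : spread u -> u = p ++ i :: q ->
  pre i (rev u) + 2 * count_mem i q <= nbc i q.
Proof.
move=> /spread_rev U E; rewrite -(count_rev _ q) -nbc_rev.
by apply: (spread_pace (q := rev p) U); rewrite E rev_cat rev_cons cat_rcons.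
Qed.

Lemma nbc_mid i p q : nbc i (p ++ i :: q) = nbc i p + nbc i q.
Proof. by rewrite nbc_cat /nbc /= adjxx. Qed.

Lemma count_mid (i : I) p q :
  count_mem i (p ++ i :: q) = (count_mem i p + count_mem i q).+1.
Proof. by rewrite count_cat /= eqxx addnS. Qed.

(** At the first [i], the bounds for the prefix and for the suffix add up; the occurrence itself
    lies in neither, whence the constant 2. *)
Lemma spread_count u i : spread u -> i \in u ->
  2 * count_mem i u + pre i u + pre i (rev u) <= nbc i u + 2.
Proof.
move=> U /first_split[p [q [E _]]].
have H1 := spread_pace U E; have H2 := spread_suffix_pace U E.
have := nbc_mid i p q; have := count_mid i p q; rewrite -E; lia.
Qed.

(** The prefix and suffix bounds add up to the assumed equality, so neither can be strict. *)
Lemma spread_exact u p i q : spread u -> u = p ++ i :: q ->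
  nbc i u + 2 = 2 * count_mem i u + pre i u + pre i (rev u) ->
  nbc i p = pre i u + 2 * count_mem i p.
Proof.
move=> U E; have H1 := spread_pace U E; have H2 := spread_suffix_pace U E.
have := nbc_mid i p q; have := count_mid i p q; rewrite -E; lia.
Qed.

(** A word as a transition from the state [f] to the state [g]: reading [i] lowers the value at [i]
    by 2 and raises it by 1 at each neighbour. The balance avoids subtraction of natural numbers. *)
Definition run (f : I -> nat) u (g : I -> nat) :=
  paced f u /\ forall i, g i + 2 * count_mem i u = f i + nbc i u.

Lemma run_nil f : run f [::] f.
Proof. by split=> [[|? ?]|]. Qed.

Lemma run_cat f g h u v : run f u g -> run g v h -> run f (u ++ v) h.
Proof.
move=> [fu fg] [gv gh]; split=> [p i q E|i]; last first.
  by have := fg i; have := gh i; rewrite nbc_cat count_cat; lia.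
have [[r [E' _]]|[r [-> E']]] := cat_cons_split E; first exact: fu E'.
have := gv _ _ _ E'; rewrite nbc_cat count_cat; have := fg i; lia.
Qed.

Lemma paced_antichain f v : uniq v -> {in v &, forall s t, ~~ adj s t} ->
  {in v, forall s, f s = 2} -> paced f v.
Proof.
move=> Uv Nv fv p i q E; have iv : i \in v by rewrite E mem_cat inE eqxx orbT.
have ip : i \notin p.
  by move: Uv; rewrite E cat_uniq /= negb_or => /and3P[_ /andP[]].
have -> : nbc i p = 0.
  by apply/eqP/nbc0P => t tp; apply: Nv => //; rewrite E mem_cat tp.
by rewrite fv // (count_memPn ip).
Qed.

(* The first letter of [u] can be moved to the front of [v], since no neighbour of it can
   be read in [v] before it. *)
Lemma paced_equiv f u v : paced f u -> paced f v -> perm_eq u v -> comm_equiv m u v.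
Proof.
elim: u f v => [|i u IH] f v fu fv uv.
  by move: uv; rewrite perm_sym => /perm_nilP->; exact: comm_equiv_refl.
have fi : f i = 2 by have := fu [::] i u erefl; rewrite /nbc /=; lia.
have /first_split[p [q [E ip]]] : i \in v by rewrite -(perm_mem uv) inE eqxx.
have Np : nbc i p = 0 by have := fv _ _ _ E; rewrite (count_memPn ip); lia.
have vE : comm_equiv m (i :: p ++ q) v.
  by rewrite E; apply: comm_equiv_sym; exact: comm_equiv_front.
apply: comm_equiv_trans vE; apply: comm_equiv_cons.
pose g j := f j + adj j i - 2 * (j == i).
have gE j : g j + 2 * (j == i) = f j + adj j i.
  by rewrite /g; case: eqP => [->|_]; rewrite ?fi; lia.
have {}uv : perm_eq u (p ++ q).
  by rewrite -(perm_cons i) (perm_trans uv) // E -cat1s perm_catCA.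
apply: (IH g) uv => [p' j q' E'|].
  have := fu (i :: p') j q'; rewrite E' => /(_ erefl); have := gE j.
  rewrite /nbc /= (eq_sym i); lia.
move=> p' j q' Epq; have := gE j.
have [[r [Ep _]]|[r [-> Eq]]] := cat_cons_split Epq.
  have jp : j \in p by rewrite Ep mem_cat inE eqxx orbT.
  rewrite (negPf (_ : j != i)); last by apply: contraNneq ip => <-.
  have /nbc0P/(_ j jp) := introT eqP Np; rewrite adjC => /negPf->.
  have := fv p' j (r ++ i :: q); rewrite E Ep -catA /= => /(_ erefl); lia.
have := fv (p ++ i :: r) j q'; rewrite E Eq -catA /= => /(_ erefl).
rewrite !nbc_cat !count_cat /nbc /= (eq_sym i); lia.
Qed.

Lemma count_mem_gt0 (i : I) u : (0 < count_mem i u) = (i \in u).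
Proof. by rewrite -has_count has_pred1. Qed.

Lemma run_pre f g u i : run f u g -> i \in u -> pre i u = 2 - f i.
Proof.
move=> [fu _] /first_split[p [q [E ip]]]; have := fu _ _ _ E.
by rewrite (count_memPn ip) E pre_first //; lia.
Qed.

(** The state at [i] is 0 just after the last [i], so its final value counts the neighbours read
    since. *)
Lemma run_pre_rev f g u i : run f u g -> i \in u -> pre i (rev u) = g i.
Proof.
move=> [fu fg] /last_split[p [q [E iq]]]; have := fu _ _ _ E; have := fg i.
rewrite E nbc_mid count_mid (count_memPn iq) rev_cat rev_cons cat_rcons.
by rewrite pre_first ?mem_rev // nbc_rev; lia.
Qed.

(** * Diagram symmetries acting on words *)

Section Automorphism.
Variable sigma : I -> I.
Hypothesis sigmaK : involutive sigma.
Hypothesis sigma_m : forall s t, m (sigma s) (sigma t) = m s t.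

Lemma adj_sigma s t : adj (sigma s) (sigma t) = adj s t.
Proof. by rewrite /adj sigma_m. Qed.

Lemma nbc_map s u : nbc (sigma s) (map sigma u) = nbc s u.
Proof. by rewrite /nbc count_map; apply: eq_count => t; exact: adj_sigma. Qed.

Lemma count_mem_map s u : count_mem (sigma s) (map sigma u) = count_mem s u.
Proof.
by rewrite count_map; apply: eq_count => t; rewrite /= (inj_eq (inv_inj sigmaK)).
Qed.

Lemma pre_map s u : pre (sigma s) (map sigma u) = pre s u.
Proof. by elim: u => //= t u ->; rewrite (inj_eq (inv_inj sigmaK)) adj_sigma. Qed.

Lemma map_sigma_split u p s q : map sigma u = p ++ s :: q ->
  u = map sigma p ++ sigma s :: map sigma q.
Proof. by move/(congr1 (map sigma)); rewrite (mapK sigmaK) map_cat. Qed.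

Lemma mem_map_sigma s u : (sigma s \in map sigma u) = (s \in u).
Proof. by rewrite (mem_map (inv_inj sigmaK)). Qed.

Lemma spread_map u : spread u -> spread (map sigma u).
Proof.
move=> U p s q r /map_sigma_split; rewrite map_cat /= => E sq.
rewrite -[s]sigmaK -[q](mapK sigmaK) nbc_map; apply: U E _.
by rewrite mem_map_sigma.
Qed.

Lemma lirr_map u : lirr u -> lirr (map sigma u).
Proof.
move=> L s t; rewrite -[s]sigmaK -[t]sigmaK !mem_map_sigma !pre_map adj_sigma.
exact: L.
Qed.

Lemma run_map f g u : run f u g ->
  run (fun i => f (sigma i)) (map sigma u) (fun i => g (sigma i)).
Proof.
move=> [fu fg]; split=> [p i q /map_sigma_split/fu|i].
  by rewrite -(nbc_map (sigma i)) -(count_mem_map (sigma i)) (mapK sigmaK) sigmaK.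
by have := fg (sigma i); rewrite -nbc_map -count_mem_map sigmaK.
Qed.

Lemma comm_equiv_map u v : comm_equiv m u v -> comm_equiv m (map sigma u) (map sigma v).
Proof.
elim=> {u v} [_ _ [a b s t st]|u|u v _|u v w _ IH1 _].
- rewrite !map_cat; apply: rst_step; apply: CommStep; by rewrite sigma_m.
- exact: comm_equiv_refl.
- exact: comm_equiv_sym.
- exact: comm_equiv_trans.
Qed.

End Automorphism.

(** * Discharging: initial letters and the inequality at each vertex *)

Definition src u i := (i \in u) && (pre i u == 0).

Lemma src_le_count u i : src u i <= count_mem i u.
Proof. by rewrite /src -count_mem_gt0; case: count => //= k; case: eqP. Qed.

Definition nsrc u i := \sum_(j | adj i j) src u j.

(** By [pre0_before], every initial letter adjacent to [i] occurs before the first [i]. *)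
Lemma nsrc_le_pre u i : i \in u -> nsrc u i <= pre i u.
Proof.
move=> /first_split[p [q [E ip]]]; rewrite E pre_first // nbc_sum.
apply: leq_sum => j ij; rewrite -E /src; case: (boolP (_ && _)) => // /andP[ju /eqP pj].
by rewrite count_mem_gt0 (@pre0_before i j p q) -?E.
Qed.

Lemma lirr_nsrc u i : lirr u -> i \in u -> pre i u = 1 -> nsrc u i = 0.
Proof.
move=> U iu pi; rewrite /nsrc big1 // => j ij; case: (boolP (src u j)) => //.
by case/andP=> ju /eqP pj; have := U j i ju iu pj pi; rewrite adjC ij.
Qed.

(** Three cases: an initial [i] has no neighbour before it; if exactly one neighbour precedes it,
    [lirr] says that no neighbour is initial; otherwise [nsrc u i <= pre i u] suffices. Equality can
    hold only for [pre i u <= 2]. *)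
Lemma nsrc_bound u i : lirr u -> i \in u ->
  nsrc u i + 2 <= 2 * pre i u + 2 * src u i.
Proof.
move=> U iu; have := nsrc_le_pre iu; have := lirr_nsrc U iu; rewrite /src iu /=.
case: (pre i u) => [|[|k]] /=; lia.
Qed.

Lemma nsrc_out u i : nsrc u i <= nbc i u.
Proof.
by rewrite nbc_sum; apply: leq_sum => j _; exact: src_le_count.
Qed.

(** * Affine marks and tightness of the inequalities *)

Section Affine.
Variable delta : I -> nat.
Hypothesis delta_gt0 : forall i, 0 < delta i.
Hypothesis delta_affine : forall j, \sum_(i | adj j i) delta i = 2 * delta j.

(** Exchange the two sums: the vertices adjacent to [j] have total mark [2 * delta j]. *)
Lemma delta_sum_adj (g : I -> nat) :
  \sum_i delta i * \sum_(j | adj i j) g j = \sum_j 2 * (delta j * g j).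
Proof.
under eq_bigr do rewrite big_distrr /=.
rewrite (exchange_big_dep predT) //=; apply: eq_bigr => j _.
rewrite -big_distrl /= mulnA -delta_affine; congr (_ * _).
by apply: eq_bigl => i; rewrite adjC.
Qed.

Lemma eq_leq_sum (F G : I -> nat) : (forall i, F i <= G i) ->
  \sum_i F i = \sum_i G i -> forall i, F i = G i.
Proof.
move=> FG E i; apply/eqP; rewrite eqn_leq FG /= leqNgt; apply/negP => lt.
have: \sum_i F i < \sum_i G i; last by rewrite E ltnn.
by rewrite (bigD1 i) // [X in _ < X](bigD1 i) //= -addSn leq_add // leq_sum.
Qed.

(* Both sides have the same sum against [delta]; the inequality [<=] holds pointwise. *)
Lemma tight u : spread u -> lirr u -> lirr (rev u) -> forall i,
  4 * count_mem i u + nsrc u i + nsrc (rev u) i =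
  2 * nbc i u + 2 * src u i + 2 * src (rev u) i.
Proof.
move=> U L R i; apply/eqP; rewrite -(eqn_pmul2l (delta_gt0 i)); apply/eqP.
move: i; apply: eq_leq_sum => [i|].
  rewrite leq_mul2l; apply/orP; right; have [iu|iu] := boolP (i \in u).
    have riu : i \in rev u by rewrite mem_rev.
    have := spread_count U iu; have := nsrc_bound L iu; have := nsrc_bound R riu.
    lia.
  have := nsrc_out u i; have := nsrc_out (rev u) i; rewrite nbc_rev.
  by rewrite (count_memPn iu) /src mem_rev (negPf iu) /=; lia.
have cE : \sum_i delta i * nbc i u = \sum_i 2 * (delta i * count_mem i u).
  by rewrite -delta_sum_adj; apply: eq_bigr => i _; rewrite nbc_sum.
have sE v : \sum_i delta i * nsrc v i = \sum_i 2 * (delta i * src v i).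
  exact: delta_sum_adj.
transitivity (2 * \sum_i 2 * (delta i * count_mem i u) +
  \sum_i 2 * (delta i * src u i) + \sum_i 2 * (delta i * src (rev u) i)).
  rewrite -!sE big_distrr /= -!big_split /=; apply: eq_bigr => i _; lia.
by rewrite -cE big_distrr /= -!big_split /=; apply: eq_bigr => i _; lia.
Qed.

(** Equality in [tight] forces equality in [spread_count], and in [nsrc_bound] at both ends of the
    word. *)
Lemma tight_pre u i : spread u -> lirr u -> lirr (rev u) -> i \in u ->
  [/\ nbc i u + 2 = 2 * count_mem i u + pre i u + pre i (rev u),
      pre i u <= 2 & nsrc u i = if pre i u == 2 then 2 else 0].
Proof.
move=> U L R iu; have := tight U L R i.
have riu : i \in rev u by rewrite mem_rev.
have := spread_count U iu; have := nsrc_bound L iu; have := nsrc_bound R riu.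
have := nsrc_le_pre iu; have := nsrc_le_pre riu.
have := lirr_nsrc L iu; have := lirr_nsrc R riu.
rewrite /src iu riu /=.
case: (pre i u) => [|[|[|k]]]; case: (pre i (rev u)) => [|[|[|l]]] /=; split; lia.
Qed.

(** At the missing vertex [i], tightness says that every occurrence of a neighbour is initial, both
    in [u] and in its reverse. So [j] occurs once, with no neighbour before or after it. *)
Lemma tight_out u i j : spread u -> lirr u -> lirr (rev u) ->
  i \notin u -> adj i j -> j \in u -> nbc j u = 0.
Proof.
move=> U L R iu ij ju; have := tight U L R i.
have := nsrc_out u i; have := nsrc_out (rev u) i; rewrite nbc_rev.
rewrite (count_memPn iu) /src mem_rev (negPf iu) /= => H1 H2 H.
have [E1 E2] : nsrc u i = nbc i u /\ nsrc (rev u) i = nbc i u by lia.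
have sE v : nsrc v i = nbc i v -> src v j = count_mem j v :> nat.
  rewrite nbc_sum /nsrc (bigD1 j) //= [RHS](bigD1 j) //= => E.
  apply/eqP; rewrite eqn_leq src_le_count.
  rewrite -(leq_add2r (\sum_(k | adj i k && (k != j)) src v k)).
  by rewrite E leq_add2l leq_sum // => k _; exact: src_le_count.
have S1 := sE u E1; have S2 : src (rev u) j = count_mem j u :> nat.
  by rewrite sE ?count_rev // E2 nbc_rev.
have c0 : 0 < count_mem j u by rewrite count_mem_gt0.
have [P1 _ _] := tight_pre U L R ju; move: S1 S2 P1 c0; rewrite /src mem_rev ju /=.
by case: eqP => [->|_]; case: eqP => [->|_]; case: (count _ _) => [|[|k]] //=; lia.
Qed.

End Affine.

Lemma isolated_uniq u : spread u -> (forall i, i \in u -> nbc i u = 0) ->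
  uniq u /\ {in u &, forall s t, ~~ adj s t}.
Proof.
move=> U N; split; last by move=> s t su tu; have /nbc0P := introT eqP (N s su); exact.
apply: count_mem_uniq => s; case: (boolP (s \in u)) => [su|/count_memPn-> //].
apply/eqP; have := spread_count U su; rewrite N // eqn_leq count_mem_gt0 su andbT.
by case: (count _ _) => [|[|k]] //=; lia.
Qed.

(** * The numbers game *)

Section NumbersGame.
Local Open Scope ring_scope.
Import GRing.Theory.

(** The opposite of the Cartan matrix. *)
Definition cox_entry s t : int := if s == t then - 2 else (adj s t)%:R.

(* Mozes's numbers game, i.e. the dual of the geometric representation: an invariant of
   words that shows that products of distinct commuting generators are reduced. *)
Definition fire (f : {ffun I -> int}) s : {ffun I -> int} :=
  [ffun t => f t + cox_entry s t * f s].

Definition play u f := foldl fire f u.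

Lemma cox_entryC s t : cox_entry s t = cox_entry t s.
Proof. by rewrite /cox_entry eq_sym adjC. Qed.

Lemma cox_entryss s : cox_entry s s = - 2.
Proof. by rewrite /cox_entry eqxx. Qed.

Lemma play_rel i j f : play (flatten (nseq (m i j) [:: i; j])) f = f.
Proof.
apply/ffunP => t; have [<-|ij] := eqVneq i j.
  by rewrite m_diag /= !ffunE cox_entryss; ring.
have eE : cox_entry i j = (adj i j)%:R by rewrite /cox_entry (negPf ij).
have eE' : cox_entry j i = (adj i j)%:R by rewrite cox_entryC.
case/orP: (m_offdiag ij) => /eqP mij;
  rewrite mij /= !ffunE !cox_entryss eE eE' /adj mij /=; ring.
Qed.

Lemma play_equiv u v f : cox_equiv m u v -> play u f = play v f.
Proof.
elim=> {u v} // [_ _ [a b i j]|u v w _ -> _ //].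
by rewrite /play !foldl_cat -!/(play _ _) play_rel.
Qed.

Lemma play_away u f s : s \notin u -> nbc s u = 0%N -> play u f s = f s.
Proof.
elim: u f => //= t u IH f; rewrite inE negb_or => /andP[st su].
rewrite /nbc /= -/(nbc s u); case: (boolP (adj s t)) => // nst N.
by rewrite IH // ffunE /cox_entry eq_sym (negPf st) adjC (negPf nst) mul0r addr0.
Qed.

Definition unit_vector s : {ffun I -> int} := [ffun t => (t == s)%:R].

(** Every letter other than [s] fires a coordinate equal to 0, which changes nothing. *)
Lemma play_unit_vector u s : s \notin u -> play u (unit_vector s) = unit_vector s.
Proof.
elim: u => //= t u IH; rewrite inE negb_or => /andP[st su].
rewrite (_ : fire _ _ = unit_vector s) ?IH //; apply/ffunP => x.
by rewrite !ffunE (eq_sym t) (negPf st) mulr0 addr0.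
Qed.

(** Only the letter [s] itself can change the coordinate [s], and it turns 1 into -1. *)
Lemma play_antichain u s : uniq u -> {in u &, forall i j, ~~ adj i j} -> s \in u ->
  play u (unit_vector s) s = - 1.
Proof.
move=> Uu Nu su; have [p [q [E sp]]] := first_split su.
have := Uu; rewrite E cat_uniq /= negb_or => /and3P[_ /andP[_ _] /andP[sq _]].
have N p' : {subset p' <= u} -> nbc s p' = 0%N.
  by move=> sub; apply/eqP/nbc0P => t tp; apply: Nu => //; exact: sub.
rewrite /play foldl_cat /= -!/(play _ _) play_away //; last first.
  by apply: N => t tq; rewrite E mem_cat inE tq !orbT.
rewrite ffunE cox_entryss play_away //; last by apply: N => t tp; rewrite E mem_cat tp.
by rewrite ffunE eqxx /=; ring.
Qed.

End NumbersGame.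

(** * Reduced expressions in a simply laced Coxeter group *)

Section Group.
Variable W : coxeterSystem m.
Implicit Types w x : W.
Local Notation gen := (@cox_gen I m W).
Local Notation wprod := (wprod W).
Local Open Scope group_scope.

Lemma wprod_cat u v : wprod (u ++ v) = wprod u * wprod v.
Proof. by rewrite /Defs.wprod big_cat. Qed.

Lemma wprod_cons s u : wprod (s :: u) = gen s * wprod u.
Proof. by rewrite /Defs.wprod big_cons. Qed.

Lemma wprod_nil : wprod [::] = 1.
Proof. by rewrite /Defs.wprod big_nil. Qed.

Lemma wprod_rel i j : wprod (flatten (nseq (m i j) [:: i; j])) = 1.
Proof.
rewrite -wprod_nil; apply/cox_presented/rst_step.
by rewrite -{2}[[::]]/([::] ++ [::]) -[flatten _]cats0; exact: (CoxStep _ [::]).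
Qed.

Lemma genK s : gen s * gen s = 1.
Proof. by have := wprod_rel s s; rewrite m_diag /= !wprod_cons wprod_nil mulg1. Qed.

Lemma genV s : (gen s)^-1 = gen s.
Proof. by apply/mulg1_eq/genK. Qed.

Lemma gen_mulK s x : gen s * (gen s * x) = x.
Proof. by rewrite mulgA genK mul1g. Qed.

Lemma gen_comm s t : m s t = 2 -> gen s * gen t = gen t * gen s.
Proof.
move=> st; have := wprod_rel s t; rewrite st /= !wprod_cons wprod_nil mulg1 mulgA => E.
by rewrite -[LHS]invgK (mulg1_eq E) invgM !genV.
Qed.

Lemma gen_braid s t : m s t = 3 -> wprod [:: s; t; s] = wprod [:: t; s; t].
Proof.
move=> st; have := wprod_rel s t.
rewrite st (_ : flatten _ = [:: s; t; s] ++ [:: t; s; t]) // wprod_cat => /mulg1_eq <-.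
by rewrite !wprod_cons wprod_nil mulg1 !invgM !genV mulgA.
Qed.

Lemma comm_equiv_wprod u v : comm_equiv m u v -> wprod u = wprod v.
Proof.
move: u v; apply: comm_equiv_invariant => a b s t st.
by rewrite !wprod_cat !wprod_cons !(mulgA (gen _)) (gen_comm st).
Qed.

Lemma wprod_rev u : wprod (rev u) = (wprod u)^-1.
Proof.
elim: u => [|s u IH]; first by rewrite wprod_nil invg1.
by rewrite rev_cons -cats1 wprod_cat IH !wprod_cons wprod_nil mulg1 invgM genV.
Qed.

Lemma ell_le u : ell (wprod u) <= size u.
Proof.
rewrite /ell; case: ex_minnP => k _; apply.
by apply/existsP; exists (in_tuple u); apply/eqP.
Qed.

Lemma ell_le_expr u w : wprod u = w -> ell w <= size u.
Proof. by move=> <-; exact: ell_le. Qed.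

Lemma reduced_exists w : exists u, reduced_expr u w.
Proof.
rewrite /reduced_expr /ell; case: ex_minnP => k /existsP[u /eqP uw] _.
by exists u; rewrite size_tuple.
Qed.

Lemma reduced_min u w : wprod u = w -> size u <= ell w -> reduced_expr u w.
Proof. by move=> uw le; split=> //; apply/eqP; rewrite eqn_leq le ell_le_expr. Qed.

Lemma reduced_suffix u v w : reduced_expr (u ++ v) w -> reduced_expr v (wprod v).
Proof.
move=> [uvw uvs]; apply: reduced_min => //.
have [v' [v'w v's]] := reduced_exists (wprod v).
have /ell_le_expr : wprod (u ++ v') = w by rewrite wprod_cat v'w -wprod_cat.
by rewrite -uvs !size_cat -v's leq_add2l.
Qed.

Lemma reduced_inv u w : reduced_expr u w -> reduced_expr (rev u) w^-1.
Proof.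
move=> [uw us]; apply: reduced_min; first by rewrite wprod_rev uw.
have [v [vw <-]] := reduced_exists w^-1.
have /ell_le_expr : wprod (rev v) = w by rewrite wprod_rev vw invgK.
by rewrite !size_rev us.
Qed.

Lemma ellV w : ell w^-1 = ell w.
Proof.
have [u uw] := reduced_exists w; have [_ <-] := uw.
by have [_ <-] := reduced_inv uw; rewrite size_rev.
Qed.

Lemma DLP s w : reflect (exists v, reduced_expr (s :: v) w) (s \in DL w).
Proof.
rewrite inE; apply: (iffP idP) => [lt|[v [vw vs]]].
  have [v [vw vs]] := reduced_exists (gen s * w); exists v.
  by apply: reduced_min; rewrite /= ?vs // wprod_cons vw gen_mulK.
by rewrite -vs ltnS; apply: ell_le_expr; rewrite -vw wprod_cons gen_mulK.
Qed.

Lemma DL_cons s t v w : reduced_expr (s :: t :: v) w -> t \in DL (gen s * w).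
Proof.
move=> H; apply/DLP; exists v; have := @reduced_suffix [:: s] (t :: v) w H.
by have [<- _] := H; rewrite (wprod_cons s) gen_mulK.
Qed.

Lemma DR_inv w : DR w = DL w^-1.
Proof. by apply/setP => s; rewrite !inE -(ellV (w * gen s)) invgM genV ellV. Qed.

Lemma right_star_inv s t w : right_star_reducible s t w <-> left_star_reducible s t w^-1.
Proof.
by rewrite /right_star_reducible !DR_inv invgM genV.
Qed.

Lemma comm_equiv_reduced u v w :
  comm_equiv m u v -> reduced_expr u w -> reduced_expr v w.
Proof.
move=> uv [<- us]; split; first by rewrite (comm_equiv_wprod uv).
by rewrite -us (perm_size (comm_equiv_perm uv)).
Qed.

Lemma FC_inv w : FC W w -> FC W w^-1.
Proof.
move=> H u v /reduced_inv; rewrite invgK => ru /reduced_inv; rewrite invgK => rv.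
by rewrite -[u]revK -[v]revK; apply: comm_equiv_rev; exact: H.
Qed.

(** With no neighbour in between, the two [s] meet and cancel, against reducedness. With a single
    one, a braid relation applies and changes the number of letters [s], which commutations
    preserve. *)
Lemma FC_spread u w : FC W w -> reduced_expr u w -> spread u.
Proof.
move=> fc red p s q r E sq; rewrite leqNgt; apply/negP; rewrite ltnS => le1.
have [uw us] := red.
have [N0|] := posnP (nbc s q).
  have uE : comm_equiv m u (p ++ (q ++ [:: s]) ++ s :: r).
    rewrite E -cat_cons; exact: comm_equiv_cat (comm_equiv_jump sq N0).
  have /ell_le_expr : wprod (p ++ q ++ r) = w.
    rewrite -uw (comm_equiv_wprod uE) -!catA !wprod_cat !wprod_cons wprod_nil mulg1.
    by rewrite gen_mulK.
  by rewrite -us E !size_cat /= !size_cat /=; lia.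
rewrite -has_count => /hasP[t tq st].
have [q1 [q2 [Eq tq1]]] := first_split tq.
have nbcE : nbc s q = (nbc s q1 + nbc s q2).+1.
  by rewrite Eq nbc_cat /nbc /= st addnS.
have [N1 N2] : nbc s q1 = 0 /\ nbc s q2 = 0 by lia.
move: sq; rewrite Eq mem_cat inE !negb_or => /and3P[sq1 nst sq2].
have uE : comm_equiv m u ((p ++ q1) ++ [:: s; t; s] ++ (q2 ++ r)).
  rewrite E Eq; apply: (@comm_equiv_trans (p ++ (q1 ++ [:: s]) ++ t :: q2 ++ s :: r)).
    have := comm_equiv_cat p (t :: q2 ++ s :: r) (comm_equiv_jump sq1 N1).
    by rewrite /= -!catA.
  have := comm_equiv_cat (p ++ q1 ++ [:: s; t]) r (comm_equiv_jump sq2 N2).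
  by move/comm_equiv_sym; rewrite /= -!catA.
have vE : reduced_expr ((p ++ q1) ++ [:: t; s; t] ++ (q2 ++ r)) w.
  have [H1 H2] := comm_equiv_reduced uE red.
  split; last by rewrite -H2 !size_cat.
  rewrite -H1 (wprod_cat _ ([:: t; s; t] ++ _)) (wprod_cat _ ([:: s; t; s] ++ _)).
  rewrite (wprod_cat [:: t; s; t]) (wprod_cat [:: s; t; s]) gen_braid //.
  by rewrite m_sym; apply/eqP.
have /comm_equiv_perm/permP/(_ (pred1 s)) := fc _ _ (comm_equiv_reduced uE red) vE.
by rewrite !count_cat /= !eqxx (eq_sym t) (negPf nst); lia.
Qed.

(** First [s] moves to the front; it is then the only neighbour before the first [t], which can move
    right behind it. *)
Lemma mem_reduced_split s t u w : reduced_expr u w -> s \in u -> t \in u ->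
  adj s t -> pre s u = 0 -> pre t u = 1%N -> exists r, comm_equiv m u (s :: t :: r).
Proof.
move=> red /first_split[p [q [E sp]]] tu st ps pt.
have Np : nbc s p = 0 by move: ps; rewrite E pre_first.
have uE : comm_equiv m u (s :: p ++ q) by rewrite E; exact: comm_equiv_front.
have nst := adj_neq st.
have : t \in p ++ q.
  by move: tu; rewrite (perm_mem (comm_equiv_perm uE)) inE eq_sym (negPf nst).
move: (comm_equiv_pre t uE); rewrite pt /= (negPf nst) adjC st => -[/esym pt'].
move=> /first_split[p' [q' [E' tp]]]; exists (p' ++ q').
apply: comm_equiv_trans uE _; apply: comm_equiv_cons; rewrite E'.
by apply: comm_equiv_front => //; rewrite -pt' E' pre_first.
Qed.

(** A left star reduction amounts to a reduced word beginning with adjacent letters [s], [t], where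
    [pre s] is 0 and [pre t] is 1. By full commutativity both values can be read on [u]. *)
Lemma left_star_lirr u w : FC W w -> reduced_expr u w ->
  lirr u <-> forall s t, ~ left_star_reducible s t w.
Proof.
move=> fc red; split=> [L s t [/DLP[v [vw vs]] /DLP[r [rw rs]] st]|L s t su tu ps pt].
  have rE : comm_equiv m u [:: s, t & r].
    apply: fc => //; apply: reduced_min; first by rewrite wprod_cons rw gen_mulK.
    rewrite -vs -[size _]/(size (t :: r)).+1 rs ltnS; apply: ell_le_expr.
    by rewrite -vw wprod_cons gen_mulK.
  rewrite ge3_adj in st; have nst := adj_neq st.
  have uE i : (i \in u) = (i \in [:: s, t & r]) := perm_mem (comm_equiv_perm rE) i.
  have: ~~ adj s t; last by rewrite st.
  apply: L; rewrite ?uE ?inE ?eqxx ?orbT // (comm_equiv_pre _ rE) /= ?eqxx //.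
  by rewrite (negPf nst) adjC st.
apply/negP => st; have [r rE] := mem_reduced_split red su tu st ps pt.
have red' := comm_equiv_reduced rE red.
by apply: (L s t); split; [apply/DLP; exists (t :: r)|exact: DL_cons red'|rewrite ge3_adj].
Qed.

Lemma star_irreducibleP u w : FC W w -> reduced_expr u w ->
  star_irreducible W w <-> lirr u /\ lirr (rev u).
Proof.
move=> fc red; have HL := left_star_lirr fc red.
have HR := left_star_lirr (FC_inv fc) (reduced_inv red).
split=> [[_ H]|[/HL L /HR R]].
  by split; [apply/HL|apply/HR] => s t; [|rewrite -right_star_inv]; case: (H s t).
by split=> // s t; split; [exact: L|rewrite right_star_inv; exact: R].
Qed.

Lemma mem_supp u w : FC W w -> reduced_expr u w -> forall s, (s \in supp w) = (s \in u).
Proof.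
move=> fc red s; rewrite inE; apply/existsP/idP => [[v /andP[/eqP vw sv]]|su].
  have rv : reduced_expr v w by split=> //; rewrite size_tuple.
  by rewrite (perm_mem (comm_equiv_perm (fc _ _ red rv))).
have [uw us] := red; have sz : size u == ell w by rewrite us.
by exists (Tuple sz) => /=; rewrite uw eqxx.
Qed.

Lemma mem_DL u w : FC W w -> reduced_expr u w ->
  forall s, (s \in DL w) = src u s.
Proof.
move=> fc red s; apply/DLP/andP => [[v rv]|[su /eqP ps]].
  have uE := fc _ _ red rv.
  rewrite (perm_mem (comm_equiv_perm uE)) (comm_equiv_pre s uE) /= eqxx.
  by rewrite inE eqxx.
have [p [q [E sp]]] := first_split su; exists (p ++ q).
apply: comm_equiv_reduced red; rewrite E; apply: comm_equiv_front => //.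
by move: ps; rewrite E pre_first.
Qed.

Lemma wprod_play u v f : wprod u = wprod v -> play u f = play v f.
Proof. by move/cox_presented/play_equiv. Qed.

(** Complete commutativity is stated in the group; the numbers game, started at the unit vector of
    [s], tells [st] from [ts] when [s] and [t] are adjacent. *)
Lemma commute_nadj s t : commute (gen s) (gen t) -> ~~ adj s t.
Proof.
move=> st; apply/negP => ast; have nst := adj_neq ast.
have E : wprod [:: s; t] = wprod [:: t; s].
  by rewrite !wprod_cons wprod_nil !mulg1.
have /ffunP/(_ s) := wprod_play (unit_vector s) E.
rewrite /= !ffunE !eqxx /cox_entry !eqxx (eq_sym t) (negPf nst) (adjC t) ast.
by lia.
Qed.

(** A word without [s] fixes the unit vector of [s], whereas [u] gives it the coordinate -1. *)
Lemma antichain_sub u v : uniq u -> {in u &, forall s t, ~~ adj s t} ->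
  wprod u = wprod v -> {subset u <= v}.
Proof.
move=> Uu Nu E s su; apply/negPn/negP => sv.
have := play_antichain Uu Nu su.
by rewrite (wprod_play _ E) play_unit_vector // ffunE eqxx.
Qed.

Lemma antichain_reduced u : uniq u -> {in u &, forall s t, ~~ adj s t} ->
  reduced_expr u (wprod u).
Proof.
move=> Uu Nu; apply: reduced_min => //.
have [v [vw <-]] := reduced_exists (wprod u).
by apply: uniq_leq_size => //; exact: antichain_sub.
Qed.

(** By [antichain_sub] and equality of lengths, another reduced word is a rearrangement of [u]; both
    are paced from the constant state 2. *)
Lemma antichain_FC u : uniq u -> {in u &, forall s t, ~~ adj s t} -> FC W (wprod u).
Proof.
move=> Uu Nu; have [_ su] := antichain_reduced Uu Nu.
have main v : reduced_expr v (wprod u) -> comm_equiv m u v.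
  move=> [vw vs]; have sz : size v <= size u by rewrite vs su.
  have [_ uv] := uniq_min_size Uu (antichain_sub Uu Nu (esym vw)) sz.
  have Uv : uniq v by rewrite -(eq_uniq _ uv) // vs su.
  apply: (paced_equiv (f := fun=> 2)); [exact: paced_antichain| |exact: uniq_perm].
  by apply: paced_antichain => // s t; rewrite -!uv; exact: Nu.
by move=> v1 v2 /main H /main; apply: comm_equiv_trans; exact: comm_equiv_sym.
Qed.

Lemma CCP w : CC W w <->
  exists u, [/\ uniq u, {in u &, forall s t, ~~ adj s t} & w = wprod u].
Proof.
split=> -[u [Uu Nu wu]]; exists u; split=> // s t su tu.
  exact: commute_nadj (Nu s t su tu).
have [->|st] := eqVneq s t; first by [].
by apply: gen_comm; apply: nadj_m2 => //; exact: Nu.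
Qed.

Lemma lirr_antichain u : {in u &, forall s t, ~~ adj s t} -> lirr u.
Proof. by move=> Nu s t su tu _ _; exact: Nu. Qed.

Lemma CC_star_irreducible w : CC W w -> star_irreducible W w.
Proof.
move=> /CCP[u [Uu Nu ->]].
apply/(star_irreducibleP (antichain_FC Uu Nu) (antichain_reduced Uu Nu)).
by split; apply: lirr_antichain => // s t; rewrite !mem_rev; exact: Nu.
Qed.

Lemma CC_nadj w u : CC W w -> reduced_expr u w -> {in u &, forall s t, ~~ adj s t}.
Proof.
move=> /CCP[v [Uv Nv ->]] red.
have uv := perm_mem (comm_equiv_perm (antichain_FC Uv Nv red (antichain_reduced Uv Nv))).
by move=> s t; rewrite !uv; exact: Nv.
Qed.

Lemma CC_supp_expr w : CC W w -> reduced_expr (enum (supp w)) w.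
Proof.
move=> /CCP[v [Uv Nv ->]]; have red := antichain_reduced Uv Nv.
have fc := antichain_FC Uv Nv; have sE := mem_supp fc red.
apply: comm_equiv_reduced red.
apply: (paced_equiv (f := fun=> 2)); first exact: paced_antichain.
  apply: paced_antichain => //; first exact: enum_uniq.
  by move=> s t; rewrite !mem_enum !sE; exact: Nv.
by apply: uniq_perm => //; rewrite ?enum_uniq // => s; rewrite mem_enum sE.
Qed.

Lemma antichain_supp u : uniq u -> {in u &, forall s t, ~~ adj s t} ->
  forall s, (s \in supp (wprod u)) = (s \in u).
Proof. by move=> Uu Nu; exact: (mem_supp (antichain_FC Uu Nu) (antichain_reduced Uu Nu)). Qed.

(** Each factor is spelled by an enumeration of its support; additivity of lengths makes the
    concatenation reduced. *)
Lemma CFNF_expr us w : is_CFNF us w ->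
  reduced_expr (flatten [seq enum (supp x) | x <- us]) w.
Proof.
move=> [-> cc _ el _]; have red x : x \in us -> reduced_expr (enum (supp x)) x.
  by move/cc/CC_supp_expr.
apply: reduced_min; last first.
  rewrite el size_flatten /shape -map_comp sumnE big_map.
  by rewrite big_seq [X in _ <= X]big_seq; apply: leq_sum => x /red[_ <-].
elim: us red {cc el} => [|x us IH] red; first by rewrite wprod_nil big_nil.
rewrite /= wprod_cat big_cons IH; last by move=> y yus; apply: red; rewrite inE yus orbT.
by have [-> _] := red x (mem_head _ _).
Qed.

(** Reduces the conditions of a Cartier-Foata normal form to conditions on the letters of its
    layers, the support of an antichain being its set of letters. *)
Lemma CFNF_intro (ls : seq (seq I)) w :
  FC W w -> reduced_expr (flatten ls) w ->
  (forall l, l \in ls -> uniq l /\ {in l &, forall s t, ~~ adj s t}) ->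
  (forall s, (s \in nth [::] ls 0) = src (flatten ls) s) ->
  (forall k, k.+1 < size ls -> forall t, t \in nth [::] ls k.+1 ->
     exists2 s, s \in nth [::] ls k & adj s t) ->
  is_CFNF [seq wprod l | l <- ls] w.
Proof.
move=> fc red anti srcE link.
have lE l : l \in ls -> reduced_expr l (wprod l).
  by move=> /anti[Ul Nl]; exact: antichain_reduced.
have suppE k s : (s \in supp (nth 1 [seq wprod l | l <- ls] k)) = (s \in nth [::] ls k).
  have [lt|ge] := ltnP k (size ls).
    have /anti[Ul Nl] := mem_nth [::] lt.
    by rewrite (nth_map [::]) // antichain_supp.
  rewrite !nth_default ?size_map // -wprod_nil.
  by rewrite antichain_supp.
split.
- have [<- _] := red; rewrite big_map; elim: (ls) => [|l l' IH].
    by rewrite big_nil wprod_nil.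
  by rewrite /= wprod_cat big_cons IH.
- by move=> x /mapP[l /anti[Ul Nl] ->]; apply/CCP; exists l.
- by apply/setP => s; rewrite suppE srcE (mem_DL fc red).
- have [_ <-] := red; rewrite big_map size_flatten /shape sumnE big_map.
  by rewrite big_seq [RHS]big_seq; apply: eq_bigr => l /lE[].
- move=> k; rewrite size_map => kl t; rewrite suppE => /(link k kl)[s sl st].
  by exists s; rewrite ?suppE ?ge3_adj.
Qed.

End Group.
End Words.

(** * The diagram of type D~ *)

Section DtildeWords.
Variable n : nat.
Hypothesis n_ge2 : 2 <= n.
Local Notation I := 'I_n.+3.
Local Notation m := (Dtilde n).
Local Notation adj := (adj m).
Local Notation pre := (pre m).
Local Notation nbc := (nbc m).
Implicit Types (i j s t : I) (u v : seq I) (k l : nat).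

Lemma Dtilde_diag i : m i i = 1.
Proof. by rewrite /Dtilde eqxx. Qed.

Lemma Dtilde_sym i j : m i j = m j i.
Proof. by rewrite /Dtilde eq_sym orbC. Qed.

Lemma Dtilde_offdiag i j : i != j -> (m i j == 2) || (m i j == 3).
Proof. by rewrite /Dtilde => /negPf->; case: ifP. Qed.

(** Indices are natural numbers here, so that neighbour sums expand into explicit terms. For [n = 2]
    the vertex 2 is adjacent to all four leaves, hence the two separate case distinctions. *)
Definition nbrs k : seq nat :=
  if k <= 1 then [:: 2] else if n < k then [:: n] else
  (if k == 2 then [:: 0; 1] else [:: k.-1]) ++
  (if k == n then [:: n.+1; n.+2] else [:: k.+1]).

Lemma nbrs_left k : k <= 1 -> nbrs k = [:: 2].
Proof. by rewrite /nbrs => ->. Qed.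

Lemma nbrs_right k : n < k -> nbrs k = [:: n].
Proof. by rewrite /nbrs => nk; rewrite nk (_ : (k <= 1) = false) //; lia. Qed.

Lemma mem_nbrs_inner k l : 2 <= k <= n -> l \in nbrs k =
  (if k == 2 then l <= 1 else l == k.-1) || (if k == n then n < l < n.+3 else l == k.+1).
Proof.
move=> /andP[k2 kn]; rewrite /nbrs leqNgt k2 ltnNge kn /= mem_cat; congr (_ || _).
  by case: ifP => _; rewrite !inE //; lia.
by case: ifP => _; rewrite !inE //; lia.
Qed.

Variant edge_spec k l : Prop :=
  | EdgeLeft of k <= 1 & l = 2
  | EdgeInner of 2 <= k < n & l = k.+1
  | EdgeRight of k = n & n < l < n.+3.

Lemma edgeP k l : reflect (edge_spec k l) (Dtilde_edge n k l).
Proof.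
apply: (iffP idP) => [|[]]; rewrite /Dtilde_edge.
- by case/or4P => [|||/orP[]] /andP[] kE /eqP->; [constructor 1|constructor 1|
    constructor 2|constructor 3|constructor 3] => //; lia.
- by move=> k1 ->; have [->|->] : k = 0 \/ k = 1 by lia.
- by move=> kE ->; rewrite eqxx andbT (_ : _ <= _ <= _) ?orbT //; lia.
- move=> -> lE; have [->|->] : l = n.+1 \/ l = n.+2 by lia.
    by rewrite !eqxx !orbT.
  by rewrite !eqxx !orbT.
Qed.

Lemma mem_nbrs k l : k < n.+3 -> l < n.+3 ->
  (l \in nbrs k) = Dtilde_edge n k l || Dtilde_edge n l k.
Proof.
move=> kn ln; have [k1|k1] := leqP k 1.
  rewrite nbrs_left // inE; apply/eqP/orP => [->|]; first by left; apply/edgeP; constructor 1.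
  by case=> /edgeP[]; lia.
have [nk|nk] := ltnP n k.
  rewrite nbrs_right // inE; apply/eqP/orP => [->|].
    by right; apply/edgeP; constructor 3; rewrite ?nk.
  by case=> /edgeP[]; lia.
rewrite mem_nbrs_inner ?k1 //; apply/orP/orP => -[].
- case: (k =P 2) => [->|k2] lk; right; apply/edgeP; first by constructor 1.
  by constructor 2; lia.
- case: (k =P n) => [->|k2] lk; left; apply/edgeP; first by constructor 3.
  by constructor 2; lia.
- by case/edgeP => [|kE ->|kE lE]; [lia|right; case: eqP; lia|right; rewrite kE eqxx].
- by case/edgeP => [l1 ->|lE ->|]; [left|left; case: eqP; lia|lia].
Qed.

Lemma nbrs_uniq k : uniq (nbrs k).
Proof.
rewrite /nbrs; case: (leqP k 1) => k1; [|case: (ltnP n k) => nk; [|case: (eqVneq k 2) => k2;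
  case: (eqVneq k n) => kn']]; rewrite //= ?inE; lia.
Qed.

Lemma nbrs_lt k : {in nbrs k, forall l, l < n.+3}.
Proof.
move=> l; rewrite /nbrs.
case: (leqP k 1) => k1; [|case: (ltnP n k) => nk; [|case: (eqVneq k 2) => k2;
  case: (eqVneq k n) => kn']]; rewrite !inE /=; lia.
Qed.

Lemma adjE i j : adj i j = (val j \in nbrs i).
Proof.
rewrite mem_nbrs ?ltn_ord // adj_def /Dtilde.
by have [->|_] := eqVneq i j; [case: j => k /= _; rewrite /Dtilde_edge; lia|case: ifP].
Qed.

Lemma sum_adj k (F : I -> nat) : k < n.+3 ->
  \sum_(j | adj (inord k) j) F j = \sum_(l <- nbrs k) F (inord l).
Proof.
move=> kn; rewrite -(big_map inord xpredT F) -big_filter; apply: perm_big.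
have inj : {in nbrs k &, injective (@inord n.+2)}.
  move=> l l' /nbrs_lt ln /nbrs_lt ln' /(congr1 val).
  by rewrite /= !inordK.
apply: uniq_perm; first by rewrite filter_uniq // index_enum_uniq.
  by rewrite map_inj_in_uniq ?nbrs_uniq.
move=> j; rewrite mem_filter mem_index_enum andbT adjE inordK //.
apply/idP/mapP => [jk|[l lk ->]]; first by exists (val j); rewrite ?inord_val.
by rewrite /= inordK // (nbrs_lt lk).
Qed.

(** * Letter counts and neighbour sums along the folded path *)

Definition cn u k := count_mem (inord k : I) u.

Lemma nbc_nbrs u k : k < n.+3 -> nbc (inord k) u = \sum_(l <- nbrs k) cn u l.
Proof. by move=> kn; rewrite nbc_sum sum_adj. Qed.

(* The two leaves at either end are merged into one vertex of a path 1, ..., n+1. *)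
Definition fold_leaves (F : nat -> nat) k :=
  if k == 1 then F 0 + F 1 else if k == n.+1 then F n.+1 + F n.+2 else F k.

Lemma sum_nbrs_left (F : nat -> nat) k : k <= 1 -> \sum_(l <- nbrs k) F l = F 2.
Proof. by rewrite /nbrs => ->; rewrite big_seq1. Qed.

Lemma sum_nbrs_right (F : nat -> nat) k : n < k -> \sum_(l <- nbrs k) F l = F n.
Proof.
move=> nk; rewrite /nbrs nk (_ : (k <= 1) = false) ?big_seq1 //; lia.
Qed.

Lemma sum_nbrs_inner (F : nat -> nat) k : 2 <= k <= n ->
  \sum_(l <- nbrs k) F l = fold_leaves F k.-1 + fold_leaves F k.+1.
Proof.
move=> /andP[k2 kn]; rewrite /nbrs leqNgt k2 ltnNge kn /= big_cat /= /fold_leaves.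
rewrite (_ : (k.-1 == 1) = (k == 2)); last by lia.
rewrite (_ : (k.-1 == n.+1) = false); last by lia.
rewrite (_ : (k.+1 == 1) = false); last by lia.
rewrite (_ : (k.+1 == n.+1) = (k == n)); last by lia.
by congr (_ + _); case: ifP => _; rewrite ?big_cons big_nil ?addn0.
Qed.

Lemma fold_leaves_inner (F : nat -> nat) k : 2 <= k <= n -> fold_leaves F k = F k.
Proof.
rewrite /fold_leaves => kn; rewrite (_ : (k == 1) = false); last by lia.
by rewrite (_ : (k == n.+1) = false) //; lia.
Qed.

Lemma fold_leaves_left (F : nat -> nat) : fold_leaves F 1 = F 0 + F 1.
Proof. by []. Qed.

Lemma fold_leaves_right (F : nat -> nat) : fold_leaves F n.+1 = F n.+1 + F n.+2.
Proof. by rewrite /fold_leaves eqxx; case: eqP => //; lia. Qed.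

(** The marks of the affine diagram, a null vector of its Cartan matrix. *)
Definition delta i := if (i <= 1) || (n < i) then 1 else 2.

Lemma delta_gt0 i : 0 < delta i.
Proof. by rewrite /delta; case: ifP. Qed.

Lemma delta_affine j : \sum_(i | adj j i) delta i = 2 * delta j.
Proof.
pose F k := if (k <= 1) || (n < k) then 1 else 2.
have E k : k < n.+3 -> delta (inord k) = F k by move=> kn; rewrite /delta inordK.
rewrite -[j]inord_val sum_adj // (E j) // big_seq.
under eq_bigr => l /nbrs_lt /E -> do over.
rewrite -big_seq; have F2 l : 2 <= l <= n -> F l = 2 by rewrite /F; case: ifP => //; lia.
have [j1|j1] := leqP j 1.
  by rewrite sum_nbrs_left // F2 ?n_ge2 // /F j1.
have [nj|nj] := ltnP n j.
  by rewrite sum_nbrs_right // F2 ?n_ge2 ?leqnn // /F nj orbT.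
have fF l : 1 <= l <= n.+1 -> fold_leaves F l = 2.
  have [->|l1] := eqVneq l 1; first by [].
  have [->|ln] := eqVneq l n.+1.
    by rewrite fold_leaves_right /F ltnSn leqnSn !orbT.
  by move=> ?; rewrite fold_leaves_inner ?F2 //; lia.
rewrite sum_nbrs_inner ?j1 // (F2 j) ?j1 // !fF //; lia.
Qed.

(* Numbers of neighbours preceding the first occurrence of [k] in the complete zigzags
   of the two kinds, and in a candy that starts with the leaves [x] and [y]. *)
Definition zig_left k := if k <= 1 then 0 else if k == 2 then 2 else 1.
Definition zig_right k := zig_left (n.+2 - k).
Definition candy_pre x y k :=
  if (k == x) || (k == y) then 0 else if (k <= 1) || (n < k) then 1
  else if odd k then 0 else 2.

(** The number of zeros of [b] among the two left leaves decides. If it is 1, zeros alternate along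
    the path and [n] is even: a candy. If it is 0 or 2, there are no inner zeros, and the zeros are
    exactly the two leaves of one end: a zigzag. *)
Lemma classify_pre (b : nat -> nat) :
  (forall k, k < n.+3 -> b k <= 2) ->
  (forall k, k < n.+3 -> \sum_(l <- nbrs k) (b l == 0) = if b k == 2 then 2 else 0) ->
  (exists2 k, k < n.+3 & b k = 0) ->
  ~~ [&& b 0 == 0, b 1 == 0, b n.+1 == 0 & b n.+2 == 0] ->
  [\/ forall k, k < n.+3 -> b k = zig_left k,
      forall k, k < n.+3 -> b k = zig_right k |
      ~~ odd n /\ exists x y, [/\ x <= 1, n < y < n.+3 &
         forall k, k < n.+3 -> b k = candy_pre x y k]].
Proof.
move=> b2 bsum [k0 k0n bk0] notall.
(* [z] marks the zeros of [b]; the hypothesis says that [D k.-1 + D k.+1] is 0 or 2 along the folded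
   path. *)
pose z k : nat := b k == 0; pose D := fold_leaves z.
have z1 k : z k <= 1 by rewrite /z; case: eqP.
have zsum k : k < n.+3 -> \sum_(l <- nbrs k) z l = if b k == 2 then 2 else 0 := bsum k.
have rec k : 2 <= k <= n -> D k.-1 + D k.+1 = if b k == 2 then 2 else 0.
  by move=> kn; rewrite -sum_nbrs_inner // zsum //; lia.
have leafL k : k <= 1 -> z 2 = if b k == 2 then 2 else 0.
  by move=> k1; rewrite -(sum_nbrs_left z k1) zsum //; lia.
have leafR k : n < k < n.+3 -> z n = if b k == 2 then 2 else 0.
  by move=> /andP[nk kn]; rewrite -(sum_nbrs_right z nk) zsum.
have Din k : 2 <= k <= n -> D k = z k by exact: fold_leaves_inner.
have DL : D 1 = z 0 + z 1 := fold_leaves_left z.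
have DR : D n.+1 = z n.+1 + z n.+2 := fold_leaves_right z.
(* A leaf has a single neighbour, which contributes at most 1 to a sum equal to 0 or 2. *)
have z2 : z 2 = 0 by have := leafL 0 isT; have := z1 2; case: ifP => _; lia.
have zn : z n = 0.
  by have := leafR n.+1; have := z1 n; case: ifP => _; lia.
have bleaf k : k < n.+3 -> (k <= 1) || (n < k) -> b k = 1 - z k.
  move=> kn kl; have : b k != 2.
    apply/eqP => bk; case/orP: kl => kl.
      by have := leafL k kl; rewrite bk /= z2.
    by have := leafR k; rewrite kl kn bk zn => /(_ isT).
  by rewrite /z; have := b2 k kn; case: (b k) => [|[|[|?]]].
(* Two consecutive vertices are carried along, since the recursion links [k] and [k.+2]. *)
have pat k : 2 <= k -> (k <= n -> z k = odd k && (D 1 == 1)) /\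
                      (k.+1 <= n -> z k.+1 = odd k.+1 && (D 1 == 1)).
  elim: k => // k IH; rewrite leq_eqVlt => /predU1P[[<-]|k2].
    split=> [_|n3]; first by rewrite z2.
    have := rec 2 n_ge2; rewrite (Din 3) ?n3 //=.
    have := z1 3; have := z1 0; have := z1 1; rewrite DL.
    by case: ifP => _; case: eqP; lia.
  have [IH1 IH2] := IH k2; split=> // kn.
  have := rec k.+1; rewrite /= (Din k) ?(Din k.+2); [|lia|lia].
  move=> H; have {H} : z k + z k.+2 = if b k.+1 == 2 then 2 else 0 by apply: H; lia.
  rewrite negbK -IH1; last by lia.
  by have := z1 k; have := z1 k.+2; case: ifP => _; lia.
have zin k : 2 <= k <= n -> z k = odd k && (D 1 == 1).
  by move=> /andP[k2 kn]; have [-> //] := pat k k2.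
have bin k : 2 <= k <= n -> b k = if D k.-1 + D k.+1 == 2 then 2 else 1 - z k.
  move=> kn; rewrite rec //; have := b2 k; rewrite /z.
  by case: (b k) => [|[|[|?]]] //= H; suff: 3 <= 2 by []; apply: H; lia.
have DRn : z n.+1 + z n.+2 = 0 \/ z n.+1 + z n.+2 = 2 \/ D 1 = 1.
  have := rec n; rewrite DR n_ge2 leqnn => /(_ isT).
  have [n2|n3] := eqVneq n 2.
    rewrite {1}n2 /= DL; have := z1 0; have := z1 1; have := z1 n.+1; have := z1 n.+2.
    have : ~~ [&& z 0 == 1, z 1 == 1, z n.+1 == 1 & z n.+2 == 1].
      by move: notall; rewrite /z; do 4!case: eqP.
    by case: ifP => _; lia.
  rewrite Din; last by lia.
  rewrite zin; last by lia.
  by case: (D 1 == 1) / eqP => [->|_]; [right; right|rewrite andbF; case: ifP => _; lia].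
have inner k : k < n.+3 -> (k <= 1) || (n < k) = false -> 2 <= k <= n by lia.
have {DRn} [D1|[D1 DRn]] : D 1 = 1 \/ D 1 != 1 /\ (D n.+1 = 0 \/ D n.+1 = 2).
  by case: (eqVneq (D 1) 1) => [|D1];
    [left|right; split=> //; rewrite DR; case: DRn => [|[|E]] //;
     [left|right|move: D1; rewrite E]].
  have nn : ~~ odd n by move: zn; rewrite zin ?n_ge2 ?leqnn // D1 andbT; case: odd.
  have DRn : D n.+1 = 1.
    have := rec n; rewrite n_ge2 leqnn => /(_ isT); have -> : D n.-1 = 1.
      have [->|n3] := eqVneq n 2; first by [].
      by rewrite Din ?zin ?D1; lia.
    by case: ifP => _; lia.
  have Dodd k : 1 <= k <= n.+1 -> D k = odd k.
    have [->|k1] := eqVneq k 1; first by rewrite D1.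
    have [->|kn] := eqVneq k n.+1; first by rewrite DRn /= nn.
    by move=> ?; rewrite Din ?zin ?D1 ?andbT //; lia.
  (* Exactly one leaf is a zero at each end: on the left it is 1 or 0 according to [z 1], on the
     right [n.+2] or [n.+1] according to [z n.+2]. *)
  constructor 3; split=> //; exists (z 1), (n.+1 + z n.+2).
  split; [exact: z1|by have := z1 n.+2; lia|move=> k kn].
  rewrite /candy_pre; case: (boolP ((k <= 1) || (n < k))) => kl.
    rewrite bleaf //; move: D1 DRn; rewrite DL DR.
    have := z1 0; have := z1 1; have := z1 n.+1; have := z1 n.+2.
    case/orP: kl => kl.
      have -> : (k == n.+1 + z n.+2) = false by lia.
      by have [->|->] : k = 0 \/ k = 1; [lia|case: eqP => /=; lia|case: eqP => /=; lia].
    have -> : (k == z 1) = false by have := z1 1; lia.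
    have [->|->] : k = n.+1 \/ k = n.+2 by lia.
      by case: eqP => /=; lia.
    by case: eqP => /=; lia.
  have kin := inner k kn (negbTE kl); rewrite bin //.
  rewrite !Dodd; [|lia|lia].
  have -> : (k == z 1) = false by have := z1 1; lia.
  have -> : (k == n.+1 + z n.+2) = false by lia.
  rewrite zin // D1 andbT; have -> : odd k.-1 = ~~ odd k by lia.
  by rewrite /=; case: odd.
have z0in k : 2 <= k <= n -> z k = 0 by move=> kin; rewrite zin // (negPf D1) andbF.
have Dz k : 2 <= k <= n -> D k = 0 by move=> kin; rewrite Din ?z0in.
have z_0 := z1 0; have z_1 := z1 1; have z_2 := z1 n.+1; have z_3 := z1 n.+2.
have corner : ~ (D 1 = 2 /\ D n.+1 = 2).
  by rewrite DL DR => H; move: notall; rewrite /z in H; lia.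
have D12 : D 1 = 0 \/ D 1 = 2 by rewrite DL in D1 *; lia.
have bE k : 2 <= k <= n -> b k = if D k.-1 + D k.+1 == 2 then 2 else 1.
  by move=> kin; rewrite bin // z0in.
(* [D] is 0 or 2 at both ends: two zeros contradict the existence of [k0], [corner] excludes two
   twos, and the mixed cases are the zigzags. *)
case: DRn => DRn; case: D12 => DL0.
- have : z k0 = 1 by rewrite /z bk0.
  case: (boolP ((k0 <= 1) || (n < k0))) => [kl|/negbTE /(inner k0 k0n)/z0in -> //].
  move=> zk; exfalso; have : z 0 + z 1 + (z n.+1 + z n.+2) = 0 by lia.
  have : k0 \in [:: 0; 1; n.+1; n.+2] by rewrite !inE; lia.
  by rewrite !inE => /or4P[] /eqP k0E; rewrite k0E in zk; lia.
- constructor 1 => k kn; rewrite /zig_left; have [kl|kl] := leqP k 1.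
    rewrite bleaf ?kl //; have [->|->] : k = 0 \/ k = 1 by lia.
      by lia.
    by lia.
  have [kr|kr] := ltnP n k.
    rewrite bleaf ?kr ?orbT //; have -> : (k == 2) = false by lia.
    have [->|->] : k = n.+1 \/ k = n.+2 by lia.
      by lia.
    by lia.
  rewrite bE ?kl //; have [->|k2] := eqVneq k 2.
    rewrite DL0; have [n2|n3] := eqVneq n 2; first by move: DRn; rewrite n2 => ->.
    by rewrite Dz //; lia.
  rewrite Dz; last by lia.
  have [->|kn'] := eqVneq k n; first by rewrite DRn.
  by rewrite Dz //; lia.
- constructor 2 => k kn; rewrite /zig_right /zig_left; have [kl|kl] := leqP k 1.
    have -> : (n.+2 - k <= 1) = false by lia.
    have -> : (n.+2 - k == 2) = false by lia.
    rewrite bleaf ?kl //; have [->|->] : k = 0 \/ k = 1 by lia.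
      by lia.
    by lia.
  have [kr|kr] := ltnP n k.
    rewrite bleaf ?kr ?orbT //; have -> : (n.+2 - k <= 1) = true by lia.
    have [->|->] : k = n.+1 \/ k = n.+2 by lia.
      by lia.
    by lia.
  have -> : (n.+2 - k <= 1) = false by lia.
  have -> : (n.+2 - k == 2) = (k == n) by lia.
  rewrite bE ?kl //; have [->|k2] := eqVneq k n.
    rewrite DRn; have [->|n3] := eqVneq n 2; first by rewrite DL0.
    by rewrite Dz //; lia.
  rewrite (Dz k.+1); last by lia.
  have [->|kn'] := eqVneq k 2; first by rewrite DL0.
  by rewrite Dz //; lia.
- by case: corner.
Qed.

(** * Connectedness of the diagram *)

Lemma nbrsC k l : k < n.+3 -> l \in nbrs k -> k \in nbrs l.
Proof. by move=> kn lk; have ln := nbrs_lt lk; rewrite mem_nbrs // orbC -mem_nbrs. Qed.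

Lemma Dtilde_connected (X : nat -> bool) k0 :
  (forall k l, k < n.+3 -> l \in nbrs k -> X k -> X l) -> k0 < n.+3 -> X k0 ->
  forall k, k < n.+3 -> X k.
Proof.
move=> closed k0n Xk0.
have step k : 2 <= k < n -> X k = X k.+1.
  move=> kn; have kk : k.+1 \in nbrs k by rewrite mem_nbrs /Dtilde_edge //; lia.
  have k3 : k < n.+3 by lia.
  apply/idP/idP; first exact: closed kk.
  by apply: closed (nbrsC k3 kk); lia.
have inner k : 2 <= k <= n -> X k = X 2.
  elim: k => // k IH /andP[k2 kn]; have [->|k2'] := eqVneq k 1; first by [].
  by rewrite -step ?IH //; lia.
have X2 : X 2.
  have [k01|k01] := leqP k0 1.
    by apply: (closed k0) => //; rewrite nbrs_left.
  have [nk0|nk0] := ltnP n k0.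
    rewrite -(inner n) ?n_ge2 ?leqnn //; apply: (closed k0) => //.
    by rewrite nbrs_right // inE.
  by rewrite -(inner k0) // k01.
have Xn : X n by rewrite inner // n_ge2 leqnn.
move=> k kn; have [k1|k1] := leqP k 1.
  by apply: (closed 2) => //; apply: nbrsC => //; rewrite nbrs_left.
have [nk|nk] := ltnP n k; last by rewrite inner // k1.
apply: (closed n) => //; first lia.
by apply: nbrsC => //; rewrite nbrs_right // inE.
Qed.

(** * Support and initial patterns of irreducible words *)

Section Word.
Variable u : seq I.
Hypothesis u_spread : spread m u.
Hypothesis u_lirr : lirr m u.
Hypothesis u_rirr : lirr m (rev u).

(** By [tight_out], the set of letters of [u] that have a neighbour in [u] is closed under
    adjacency. As the diagram is connected, this set is empty as soon as a letter is missing. *)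
Lemma support_dichotomy :
  (uniq u /\ {in u &, forall s t, ~~ adj s t}) \/ forall i, i \in u.
Proof.
have [/forallP ?|] := boolP [forall i, i \in u]; [by right|].
rewrite negb_forall => /existsP[i0 i0u]; left.
apply: (isolated_uniq Dtilde_diag) => // i iu.
apply/eqP; rewrite -leqn0 leqNgt; apply/negP => Ni.
pose X k := (inord k \in u) && (0 < nbc (inord k) u).
have Xcl k l : k < n.+3 -> l \in nbrs k -> X k -> X l.
  move=> kn lk /andP[ku Nk].
  have al : adj (inord l) (inord k).
    by rewrite adjE /= !inordK ?(nbrs_lt lk) // nbrsC.
  apply/andP; split.
    apply/negPn/negP => lu; move: Nk.
    by rewrite (tight_out Dtilde_diag Dtilde_sym delta_gt0
          delta_affine u_spread u_lirr u_rirr lu al ku).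
  by rewrite -has_count; apply/hasP; exists (inord k).
have Xi : X i by rewrite /X inord_val iu.
have := Dtilde_connected Xcl (ltn_ord i) Xi (ltn_ord i0).
by rewrite /X inord_val (negPf i0u).
Qed.

Hypothesis u_full : forall i, i \in u.

Definition pr v k := pre (inord k) v.

Lemma tight_count k : k < n.+3 ->
  \sum_(l <- nbrs k) cn u l + 2 = 2 * cn u k + pr u k + pr (rev u) k.
Proof.
move=> kn; rewrite -nbc_nbrs //.
by case: (tight_pre Dtilde_diag Dtilde_sym delta_gt0
          delta_affine u_spread u_lirr u_rirr (u_full (inord k))).
Qed.

(** Exactly two neighbours lie between consecutive occurrences; with [pre i u <= 2], this is the
    pace started from [2 - pre i u]. *)
Lemma tight_paced : paced m (fun i => 2 - pre i u) u.
Proof.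
move=> p i q E.
have [H1 H2 _] := tight_pre Dtilde_diag Dtilde_sym delta_gt0
          delta_affine u_spread u_lirr u_rirr (u_full i).
by rewrite (spread_exact Dtilde_diag u_spread E H1); lia.
Qed.

Lemma pre_take i v : i \in v -> pre i v = nbc i (take (index i v) v).
Proof.
move=> /first_split[p [q [-> ip]]]; rewrite pre_first // index_cat (negPf ip) /= eqxx.
by rewrite addn0 take_size_cat.
Qed.

Lemma tight_pr k : k < n.+3 -> pr u k <= 2.
Proof.
by case: (tight_pre Dtilde_diag Dtilde_sym delta_gt0
          delta_affine u_spread u_lirr u_rirr (u_full (inord k))).
Qed.

Lemma tight_pr_sum k : k < n.+3 ->
  \sum_(l <- nbrs k) (pr u l == 0) = if pr u k == 2 then 2 else 0.
Proof.
move=> kn; have [_ _ <-] := tight_pre Dtilde_diag Dtilde_sym delta_gt0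
          delta_affine u_spread u_lirr u_rirr (u_full (inord k)).
rewrite /nsrc sum_adj //; apply: eq_bigr => l _.
by rewrite /src u_full.
Qed.

(* If all four leaves came first, then each of 2, ..., n would have to come after its
   predecessor on the path, and n would have three neighbours before it. *)
Lemma tight_leaves :
  ~~ [&& pr u 0 == 0, pr u 1 == 0, pr u n.+1 == 0 & pr u n.+2 == 0].
Proof.
apply/negP => /and4P[/eqP p0 /eqP p1 /eqP p2 /eqP p3].
(* [e k l] counts the letters [l] before the first [k]. Of two distinct letters, one comes first. *)
pose e k l := cn (take (index (inord k) u) u) l.
have prE k : k < n.+3 -> pr u k = \sum_(l <- nbrs k) e k l.
  by move=> kn; rewrite /pr pre_take // nbc_nbrs.
have eor k l : k < n.+3 -> l < n.+3 -> k != l -> 0 < e k l + e l k.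
  move=> kn ln kl; rewrite addn_gt0 /e /cn !count_mem_gt0 !in_take //.
  case: ltngtP => // /(congr1 (nth ord0 u)); rewrite !nth_index //.
  by move/(congr1 val); rewrite /= !inordK // => E; rewrite E eqxx in kl.
have e20 : 0 < e 2 0.
  by have := eor 2 0; have := prE 0; rewrite sum_nbrs_left // p0; lia.
have e21 : 0 < e 2 1.
  by have := eor 2 1; have := prE 1; rewrite sum_nbrs_left // p1; lia.
have en1 : 0 < e n n.+1.
  by have := eor n n.+1; have := prE n.+1; rewrite sum_nbrs_right // p2; lia.
have en2 : 0 < e n n.+2.
  by have := eor n n.+2; have := prE n.+2; rewrite sum_nbrs_right // p3; lia.
have prI k : 2 <= k <= n ->
    pr u k = fold_leaves (e k) k.-1 + fold_leaves (e k) k.+1.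
  by move=> kn; rewrite -sum_nbrs_inner // prE //; lia.
have le2 := tight_pr.
have ch k : 2 <= k < n -> 0 < e k.+1 k /\ 0 < pr u k.
  elim: k => // k IH kn; have [k1|k1] := eqVneq k 1.
    rewrite k1; have := prI 2; have := le2 2; have := eor 2 3.
    rewrite fold_leaves_left fold_leaves_inner; last by lia.
    by lia.
  have [] := IH; [lia|move=> H1 H2].
  have := prI k.+1; have := le2 k.+1; have := eor k.+1 k.+2.
  rewrite !fold_leaves_inner /=; [|lia|lia].
  (* As [pr u k] is positive, [k.+1] does not have two initial neighbours, so a single neighbour
     precedes it, namely [k]. *)
  have := tight_pr_sum (k := k.+1); rewrite sum_nbrs_inner; last by lia.
  rewrite !fold_leaves_inner /=; [|lia|lia].
  rewrite (negPf (_ : pr u k != 0)); last by lia.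
  by case: ifP => /=; lia.
have := prI n; have := le2 n; rewrite fold_leaves_right.
have [n2|n3] := eqVneq n 2.
  have -> : fold_leaves (e n) n.-1 = e 2 0 + e 2 1 by rewrite n2.
  by lia.
rewrite fold_leaves_inner; last by lia.
have := ch n.-1; rewrite prednK; lia.
Qed.

(** The first letter of [u] supplies a vertex with value 0. *)
Lemma tight_classify :
  [\/ forall k, k < n.+3 -> pr u k = zig_left k,
      forall k, k < n.+3 -> pr u k = zig_right k |
      ~~ odd n /\ exists x y, [/\ x <= 1, n < y < n.+3 &
         forall k, k < n.+3 -> pr u k = candy_pre x y k]].
Proof.
apply: classify_pre; [exact: tight_pr|exact: tight_pr_sum| |exact: tight_leaves].
case E: {1}u (u_full ord0) => [//|s v] _; exists (val s); first exact: ltn_ord.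
by rewrite /pr inord_val E /= eqxx.
Qed.

End Word.

Lemma zig_left_le1 k : k <= 1 -> zig_left k = 0.
Proof. by rewrite /zig_left => ->. Qed.

Lemma zig_left_ge2 k : 2 <= k -> zig_left k = 1 + (k == 2).
Proof. by rewrite /zig_left ltnNge => /negbTE->; case: eqP. Qed.

Lemma candy_pre_left x y k : n < y -> k <= 1 -> candy_pre x y k = (k != x).
Proof.
move=> ny k1; rewrite /candy_pre k1 (_ : (k == y) = false) ?orbF; last by lia.
by case: eqP.
Qed.

Lemma candy_pre_right x y k : x <= 1 -> n < k -> candy_pre x y k = (k != y).
Proof.
move=> x1 nk; rewrite /candy_pre nk orbT (_ : (k == x) = false); last by lia.
by case: eqP.
Qed.

Lemma candy_pre_inner x y k : x <= 1 -> n < y -> 2 <= k <= n ->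
  candy_pre x y k = 2 * ~~ odd k.
Proof.
move=> x1 ny kn; rewrite /candy_pre (_ : (k == x) = false); last by lia.
rewrite (_ : (k == y) = false); last by lia.
rewrite (_ : (k <= 1) || _ = false); last by lia.
by case: odd.
Qed.

(** * Letter counts from linear recursions; [b] and [a] are the patterns at the two ends of the
    word *)

Section Counts.
Variables c a b : nat -> nat.
Hypothesis eqn_c : forall k, k < n.+3 ->
  \sum_(l <- nbrs k) c l + 2 = 2 * c k + b k + a k.
Hypothesis c_gt0 : forall k, k < n.+3 -> 0 < c k.

Lemma count_left k : k <= 1 -> c 2 + 2 = 2 * c k + b k + a k.
Proof. by move=> k1; rewrite -eqn_c ?sum_nbrs_left //; lia. Qed.

Lemma count_right k : n < k < n.+3 -> c n + 2 = 2 * c k + b k + a k.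
Proof. by move=> /andP[nk kn]; rewrite -eqn_c ?sum_nbrs_right. Qed.

Lemma count_inner k : 2 <= k <= n ->
  fold_leaves c k.-1 + fold_leaves c k.+1 + 2 = 2 * fold_leaves c k + b k + a k.
Proof.
by move=> kn; rewrite (fold_leaves_inner _ kn) -eqn_c ?sum_nbrs_inner //; lia.
Qed.

(** On the folded path the equations form a second order recursion whose solution is constant from 2
    to [n], with a value fixed by the equation at the leaf 0. Each round of the zigzag has one 0
    besides the starting one, so [p] is [(c 0).-1]. *)
Lemma zig_count :
  (forall k, k < n.+3 -> b k = zig_left k) ->
  (forall k, k < n.+3 -> a k = zig_left k) \/ (forall k, k < n.+3 -> a k = zig_right k) ->
  exists p h : nat, [/\ h <= 1, 0 < p + h &
    forall l, l < n.+3 -> c l = (l <= 1) + p * ((2 <= l) + (l <= n)) + h * (2 <= l)].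
Proof.
move=> bE aE; pose D := fold_leaves c.
have D1 : D 1 = c 0 + c 1 := fold_leaves_left c.
have Din k : 2 <= k <= n -> D k = c k by exact: fold_leaves_inner.
have DR : D n.+1 = c n.+1 + c n.+2 := fold_leaves_right c.
have i2 : 2 <= 2 <= n by rewrite n_ge2.
have base : D 1 + D 3 + 2 = 2 * D 2 + b 2 + a 2 := count_inner i2.
have b0 : b 0 = 0 := bE 0 isT.
have b1 : b 1 = 0 := bE 1 isT.
have bn1 : b n.+1 = 1 by rewrite bE // zig_left_ge2; lia.
have bn2 : b n.+2 = 1 by rewrite bE // zig_left_ge2; lia.
have bin k : 2 <= k <= n -> b k = 1 + (k == 2).
  by move=> kn; rewrite bE ?zig_left_ge2; lia.
have c0 := count_left (leq0n 1); have c1 := count_left (leqnn 1).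
have cn1 := @count_right n.+1; have cn2 := @count_right n.+2.
have gt0 := c_gt0 (k := 0); have gt2 := c_gt0 (k := 2).
case: aE => aE.
  have a0 : a 0 = 0 := aE 0 isT.
  have a1 : a 1 = 0 := aE 1 isT.
  have an1 : a n.+1 = 1 by rewrite aE // zig_left_ge2; lia.
  have an2 : a n.+2 = 1 by rewrite aE // zig_left_ge2; lia.
  have ain k : 2 <= k <= n -> a k = 1 + (k == 2).
    by move=> kn; rewrite aE ?zig_left_ge2; lia.
  have DE k : 2 <= k -> k <= n -> D k = 2 * (c 0).-1 /\ D k.+1 = 2 * (c 0).-1.
    elim: k => // k IH k2 kn; have [k1|k1] := eqVneq k 1.
      by rewrite k1; move: base; rewrite (bin 2 i2) (ain 2 i2) (Din 2 i2); lia.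
    have [E1 E2] := IH ltac:(lia) ltac:(lia); split=> //.
    have kin : 2 <= k.+1 <= n by lia.
    by have := count_inner kin; rewrite -/D /= E1 E2 bin // ain //; lia.
  exists (c 0).-1, 0; split=> //; first by lia.
  have [_ DnE] := DE n n_ge2 (leqnn n); rewrite DR in DnE.
  move=> l ln; have [l1|l1] := leqP l 1.
    by have [->|->] : l = 0 \/ l = 1; lia.
  have [nl|nl] := ltnP n l.
    by have [->|->] : l = n.+1 \/ l = n.+2; lia.
  by have [] := DE l l1 nl; rewrite Din ?l1 //; lia.
have a0 : a 0 = 1 by rewrite aE // /zig_right zig_left_ge2; lia.
have a1 : a 1 = 1 by rewrite aE // /zig_right zig_left_ge2; lia.
have an1 : a n.+1 = 0 by rewrite aE // /zig_right zig_left_le1; lia.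
have an2 : a n.+2 = 0 by rewrite aE // /zig_right zig_left_le1; lia.
have ain k : 2 <= k <= n -> a k = 1 + (k == n).
  by move=> kn; rewrite aE ?/zig_right ?zig_left_ge2; lia.
(* The folded right end exceeds the inner value by one, since both of its leaves occur in the last
   [zigA]. *)
have DE k : 2 <= k -> k <= n ->
    D k = (2 * (c 0).-1).+1 /\ D k.+1 = (2 * (c 0).-1).+1 + (k == n).
  elim: k => // k IH k2 kn; have [k1|k1] := eqVneq k 1.
    by rewrite k1; move: base; rewrite (bin 2 i2) (ain 2 i2) (Din 2 i2); lia.
  have [E1 E2] := IH ltac:(lia) ltac:(lia).
  have kin : 2 <= k.+1 <= n by lia.
  by have := count_inner kin; rewrite -/D /= E1 E2 bin // ain //; lia.
exists (c 0).-1, 1; split=> //; first by lia.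
have [_ DnE] := DE n n_ge2 (leqnn n); rewrite DR in DnE.
move=> l ln; have [l1|l1] := leqP l 1.
  by have [->|->] : l = 0 \/ l = 1; lia.
have [nl|nl] := ltnP n l.
  by have [->|->] : l = n.+1 \/ l = n.+2; lia.
by have [] := DE l l1 nl; rewrite Din ?l1 //; lia.
Qed.

(** Parity: the equations at the leaves 0 and 1 have the same left side and the same [b], but the
    values of [a] there are 0 and 1. *)
Lemma zig_candy_absurd x y :
  b 0 = b 1 -> x <= 1 -> n < y < n.+3 ->
  (forall k, k < n.+3 -> a k = candy_pre x y k) -> False.
Proof.
move=> b01 x1 yn aE; have := count_left (leq0n 1); have := count_left (leqnn 1).
rewrite !aE // b01 !candy_pre_left //; [|lia|lia].
by case: (x) x1 => [|[|]] //=; lia.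
Qed.

(** Adding the equations at the leaves 0 and 1 gives [c 2 + 1] for the folded left end; the
    recursion then alternates between [c 2] and [c 2 + 1]. *)
Lemma candy_count x y x' y' :
  ~~ odd n -> x <= 1 -> n < y < n.+3 -> x' <= 1 -> n < y' < n.+3 ->
  (forall k, k < n.+3 -> b k = candy_pre x y k) ->
  (forall k, k < n.+3 -> a k = candy_pre x' y' k) ->
  [/\ forall k, 2 <= k <= n -> c k = c 2 + odd k,
      forall k, k <= 1 -> 2 * c k + (k != x) + (k != x') = c 2 + 2 &
      forall k, n < k < n.+3 -> 2 * c k + (k != y) + (k != y') = c 2 + 2].
Proof.
move=> nn x1 yn x1' yn' bE aE; pose D := fold_leaves c.
have D1 : D 1 = c 0 + c 1 := fold_leaves_left c.
have Din k : 2 <= k <= n -> D k = c k by exact: fold_leaves_inner.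
have left k : k <= 1 -> 2 * c k + (k != x) + (k != x') = c 2 + 2.
  by move=> k1; rewrite (count_left k1) bE ?aE ?candy_pre_left //; lia.
have bin k : 2 <= k <= n -> b k = 2 * ~~ odd k.
  by move=> kn; rewrite bE ?candy_pre_inner //; lia.
have ain k : 2 <= k <= n -> a k = 2 * ~~ odd k.
  by move=> kn; rewrite aE ?candy_pre_inner //; lia.
have i2 : 2 <= 2 <= n by rewrite n_ge2.
have base : D 1 + D 3 + 2 = 2 * D 2 + b 2 + a 2 := count_inner i2.
have D1E : D 1 = c 2 + 1.
  by have := left 0; have := left 1; rewrite D1; lia.
have DE k : 2 <= k -> k <= n -> D k = c 2 + odd k /\ D k.+1 = c 2 + odd k.+1.
  elim: k => // k IH k2 kn; have [k1|k1] := eqVneq k 1.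
    by rewrite k1; move: base; rewrite (bin 2 i2) (ain 2 i2) (Din 2 i2) /=; lia.
  have [E1 E2] := IH ltac:(lia) ltac:(lia); split=> //.
  have kin : 2 <= k.+1 <= n by lia.
  by have := count_inner kin; rewrite -/D /= E1 E2 bin // ain //=; lia.
have inner k : 2 <= k <= n -> c k = c 2 + odd k.
  by move=> /andP[k2 kn]; have [<- _] := DE k k2 kn; rewrite Din ?k2.
split=> // k kn; have := inner n; rewrite n_ge2 leqnn (negbTE nn) addn0 => /(_ isT) <-.
by rewrite (count_right kn) bE ?aE ?candy_pre_right //; lia.
Qed.

End Counts.

(** * Zigzag words as transitions between states *)

Lemma adj_inord k l : k < n.+3 -> l < n.+3 -> adj (inord k) (inord l) = (l \in nbrs k).
Proof. by move=> kn ln; rewrite adjE /= !inordK. Qed.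

Lemma cn_cat u v k : cn (u ++ v) k = cn u k + cn v k.
Proof. exact: count_cat. Qed.

Lemma eq_cn_perm u v : (forall k, k < n.+3 -> cn u k = cn v k) -> perm_eq u v.
Proof.
move=> uv; apply/allP => i _; apply/eqP.
by have := uv i (ltn_ord i); rewrite /cn inord_val.
Qed.

Lemma nbc_counts u (c : nat -> nat) : (forall k, k < n.+3 -> cn u k = c k) ->
  forall k, k < n.+3 -> nbc (inord k) u = \sum_(l <- nbrs k) c l.
Proof.
move=> uc k kn; rewrite nbc_nbrs // big_seq [RHS]big_seq.
by apply: eq_bigr => l /nbrs_lt/uc.
Qed.

Lemma run_intro (f g c : nat -> nat) u :
  paced m (fun i => f i) u -> (forall k, k < n.+3 -> cn u k = c k) ->
  (forall k, k < n.+3 -> g k + 2 * c k = f k + \sum_(l <- nbrs k) c l) ->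
  run m (fun i => f i) u (fun i => g i).
Proof.
move=> fu uc gc; split=> // i; have iE := ltn_ord i.
have := gc i iE; rewrite -(nbc_counts uc iE) -(uc i iE) /cn inord_val; exact.
Qed.

Lemma cn_Dword ks k : all (gtn n.+3) ks -> k < n.+3 -> cn (Dword n ks) k = count_mem k ks.
Proof.
move=> /allP ksn kn; rewrite /cn count_map; apply: eq_in_count => l /ksn /= ln.
by rewrite -val_eqE /= !inordK.
Qed.

Lemma cn_Dword_iota a b k : a + b <= n.+3 -> k < n.+3 ->
  cn (Dword n (iota a b)) k = (a <= k < a + b).
Proof.
move=> abn kn; rewrite cn_Dword //; first by rewrite count_uniq_mem ?iota_uniq // mem_iota.
by apply/allP => l; rewrite mem_iota /=; lia.
Qed.

Lemma cn_zigA k : k < n.+3 -> cn (zigA n) k = (2 <= k).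
Proof. by move=> kn; rewrite cn_Dword_iota // ?kn ?andbT //; lia. Qed.

Lemma cn_rev u k : cn (rev u) k = cn u k.
Proof. exact: count_rev. Qed.

Lemma cn_zigB k : k < n.+3 -> cn (zigB n) k = (k <= n).
Proof.
move=> kn; rewrite (_ : zigB n = rev (Dword n (iota 0 n.+1))); last exact: map_rev.
by rewrite cn_rev cn_Dword_iota //; lia.
Qed.

Lemma cn_wpow u p k : cn (wpow u p) k = p * cn u k.
Proof. by elim: p => // p IH; rewrite /wpow /= cn_cat IH mulSn. Qed.

Lemma zig_rightE k : k < n.+3 ->
  zig_right k = if n < k then 0 else if k == n then 2 else 1.
Proof.
move=> kn; rewrite /zig_right; have [nk|nk] := ltnP n k.
  by rewrite zig_left_le1 //; lia.
rewrite zig_left_ge2; last by lia.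
by rewrite (_ : (n.+2 - k == 2) = (k == n)); [case: eqP|lia].
Qed.

(** The letter at position [j] of [zigA] is [2 + j], preceded by exactly [2, ..., j + 1], so the
    state at each letter is explicit. *)
Lemma run_zigA : run m (fun i => zig_left i) (zigA n) (fun i => zig_right i).
Proof.
apply: (run_intro _ cn_zigA) => [p i q E|k kn].
  have [jn Ep Ei] : [/\ size p < n.+1, p = Dword n (iota 2 (size p)) & i = inord (2 + size p)].
    have sz : size (zigA n) = n.+1 by rewrite size_map size_iota.
    have jn : size p < size (zigA n) by rewrite E size_cat /= addnS ltnS leq_addr.
    rewrite sz in jn.
    split=> //.
      have := congr1 (take (size p)) E; rewrite take_size_cat // => Ep.
      rewrite -[LHS]Ep.
      by rewrite /zigA /Dword -map_take take_iota (minn_idPl (ltnW jn)).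
    have := congr1 (nth i ^~ (size p)) E; rewrite nth_cat ltnn subnn /= => Ei.
    rewrite -[LHS]Ei.
    by rewrite (nth_map 0) ?size_iota // nth_iota.
  move: (size p) jn Ep Ei => j jn -> ->.
  have kn : 2 + j < n.+3 by lia.
  have cE k : k < n.+3 -> cn (Dword n (iota 2 j)) k = (2 <= k < 2 + j).
    by move=> ?; rewrite cn_Dword_iota //; lia.
  rewrite (nbc_counts cE kn) -/(cn _ (2 + j)) cE // ltnn andbF inordK //.
  rewrite zig_left_ge2 //; have [nj|nj] := ltnP n (2 + j).
    by rewrite sum_nbrs_right //; lia.
  rewrite sum_nbrs_inner // /fold_leaves; repeat case: eqP => ?; lia.
rewrite zig_rightE //; have [k1|k1] := leqP k 1.
  rewrite sum_nbrs_left // zig_left_le1 //.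
  by repeat case: eqP => ?; repeat case: ifP => ?; lia.
rewrite zig_left_ge2 //; have [nk|nk] := ltnP n k.
  by rewrite sum_nbrs_right //; lia.
by rewrite sum_nbrs_inner ?k1 // /fold_leaves; repeat case: eqP => ?; lia.
Qed.

(* The symmetry of the diagram exchanging its two ends swaps [zigA] and [zigB]. *)
Definition sigma i : I := rev_ord i.

Lemma sigmaK : involutive sigma.
Proof. exact: rev_ordK. Qed.

(** [k -> n + 2 - k] exchanges the left and right edges and reverses the orientation of
    [Dtilde_edge]. *)
Lemma sigma_m s t : m (sigma s) (sigma t) = m s t.
Proof.
have E k l : k < n.+3 -> l < n.+3 ->
    Dtilde_edge n (n.+3 - k.+1) (n.+3 - l.+1) = Dtilde_edge n l k.
  move=> kn ln; rewrite !subSS; apply/edgeP/edgeP => -[] H1 H2.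
  - by constructor 3; lia.
  - by constructor 2; lia.
  - by constructor 1; lia.
  - by constructor 3; lia.
  - by constructor 2; lia.
  - by constructor 1; lia.
by rewrite /Dtilde (inj_eq (inv_inj sigmaK)) /= !E // orbC.
Qed.

Lemma sigma_inord k : k < n.+3 -> sigma (inord k) = inord (n.+2 - k).
Proof. by move=> kn; apply: val_inj; rewrite /= !inordK ?subSS //; lia. Qed.

Lemma sigma_Dword ks : all (gtn n.+3) ks ->
  map sigma (Dword n ks) = Dword n [seq n.+2 - k | k <- ks].
Proof.
move=> /allP ksn; rewrite /Dword -!map_comp; apply/eq_in_map => k /ksn kn /=.
exact: sigma_inord.
Qed.

Lemma sigma_zigA : map sigma (zigA n) = zigB n.
Proof.
rewrite /zigA sigma_Dword; last by apply/allP => k; rewrite mem_iota /=; lia.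
congr (Dword n _); apply: (@eq_from_nth _ 0); rewrite size_map size_iota.
  by rewrite size_rev size_iota.
move=> k kn; rewrite (nth_map 0) ?size_iota // nth_iota // nth_rev ?size_iota //.
by rewrite nth_iota; lia.
Qed.

Lemma sigma_zigB : map sigma (zigB n) = zigA n.
Proof. by rewrite -sigma_zigA (mapK sigmaK). Qed.

Lemma zig_right_sigma i : zig_left (sigma i) = zig_right i.
Proof. by rewrite /zig_right /= subSS. Qed.

Lemma zig_left_sigma i : zig_right (sigma i) = zig_left i.
Proof. by rewrite -zig_right_sigma sigmaK. Qed.

Lemma run_eq f g f' g' u : f =1 f' -> g =1 g' -> run m f u g -> run m f' u g'.
Proof.
move=> ff gg [fu gu]; split=> [p i q E|i]; first by rewrite -ff; exact: fu E.
by rewrite -ff -gg.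
Qed.

Lemma run_zigB : run m (fun i => zig_right i) (zigB n) (fun i => zig_left i).
Proof.
have := run_map sigmaK sigma_m run_zigA; rewrite sigma_zigA.
by apply: run_eq => i; rewrite ?zig_left_sigma ?zig_right_sigma.
Qed.

Lemma run_zig_loop p :
  run m (fun i => zig_left i) (wpow (zigA n ++ zigB n) p) (fun i => zig_left i).
Proof.
elim: p => [|p IH]; first exact: run_nil.
exact: run_cat (run_cat run_zigA run_zigB) IH.
Qed.

(** The pattern at the far end of a zigzag, that is, of the reversed word. *)
Definition zig_end h k := if h == 0 then zig_left k else zig_right k.

Lemma run_zig_last h : h <= 1 ->
  run m (fun i => zig_left i) (wpow (zigA n) h) (fun i => zig_end h i).
Proof.
by case: h => [|[|]] // _; [exact: run_nil|rewrite /wpow /= cats0; exact: run_zigA].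
Qed.

Lemma run_antichain f g v : uniq v -> {in v &, forall s t, ~~ adj s t} ->
  {in v, forall s, f s = 2} -> (forall i, g i + 2 * (i \in v) = f i + nbc i v) ->
  run m f v g.
Proof.
move=> Uv Nv fv fg; split; first exact: paced_antichain.
by move=> i; rewrite count_uniq_mem.
Qed.

Lemma run_zig_start :
  run m (fun i => 2 - zig_left i) (Dword n [:: 0; 1]) (fun i => zig_left i).
Proof.
have cE k : k < n.+3 -> cn (Dword n [:: 0; 1]) k = (k <= 1).
  by move=> kn; rewrite cn_Dword // /=; lia.
apply: (run_intro (f := fun k => 2 - zig_left k) _ cE) => [|k kn].
  apply: paced_antichain => [||s].
  - by rewrite /= inE -val_eqE /= !inordK.
  - by move=> s t; rewrite !inE => /orP[]/eqP-> /orP[]/eqP->;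
      rewrite adj_inord //  nbrs_left.
  - by rewrite !inE => /orP[]/eqP->; rewrite inordK.
have [k1|k1] := leqP k 1; first by rewrite sum_nbrs_left // zig_left_le1.
rewrite zig_left_ge2 //; have [nk|nk] := ltnP n k.
  by rewrite sum_nbrs_right //; lia.
by rewrite sum_nbrs_inner ?k1 // /fold_leaves; repeat case: eqP => ?; lia.
Qed.

Definition zig p h : seq I :=
  Dword n [:: 0; 1] ++ wpow (zigA n ++ zigB n) p ++ wpow (zigA n) h.

Lemma run_zig p h : h <= 1 ->
  run m (fun i => 2 - zig_left i) (zig p h) (fun i => zig_end h i).
Proof.
move=> h1; apply: run_cat run_zig_start _.
exact: run_cat (run_zig_loop p) (run_zig_last h1).
Qed.

Lemma cn_zig p h k : k < n.+3 ->
  cn (zig p h) k = (k <= 1) + p * ((2 <= k) + (k <= n)) + h * (2 <= k).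
Proof.
move=> kn; rewrite !cn_cat !cn_wpow cn_cat cn_zigA // cn_zigB // cn_Dword // /=.
by lia.
Qed.

Lemma zig_full p h i : 0 < p + h -> i \in zig p h.
Proof.
move=> ph; have := cn_zig p h (ltn_ord i); rewrite /cn inord_val -count_mem_gt0 => ->.
by lia.
Qed.

(** The initial letters are 0 and 1, and two neighbours precede their only neighbour 2. *)
Lemma lirr_zig_left u : (forall i, pre i u = zig_left i) -> lirr m u.
Proof.
move=> uE s t _ _; rewrite !uE adjE => sE tE.
have s1 : s <= 1 by move: sE; rewrite /zig_left; case: leqP => //; case: eqP.
by rewrite nbrs_left // inE; apply: contra_eqN tE => /eqP ->.
Qed.

Lemma lirr_zig_right u : (forall i, pre i u = zig_right i) -> lirr m u.
Proof.
move=> uE; rewrite -[u](mapK sigmaK); apply: (lirr_map sigmaK sigma_m).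
apply: lirr_zig_left => i; rewrite -[i]sigmaK (pre_map sigmaK sigma_m) uE.
by rewrite -zig_right_sigma.
Qed.

Lemma zig_lirr p h : h <= 1 -> 0 < p + h -> lirr m (zig p h) /\ lirr m (rev (zig p h)).
Proof.
move=> h1 ph; have rz := run_zig p h1; split.
  apply: lirr_zig_left => i; rewrite (run_pre rz) ?zig_full // subKn //.
  by rewrite /zig_left; do ?case: ifP.
have preE i : pre i (rev (zig p h)) = zig_end h i.
  by rewrite (run_pre_rev Dtilde_diag rz) ?zig_full.
case: (h =P 0) => [h0|/eqP/negbTE h0].
  by apply: lirr_zig_left => i; rewrite preE /zig_end h0.
by apply: lirr_zig_right => i; rewrite preE /zig_end h0.
Qed.

Lemma sigma_zig p h : map sigma (zig p h) =
  Dword n [:: n.+2; n.+1] ++ wpow (zigB n ++ zigA n) p ++ wpow (zigB n) h.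
Proof.
have sw u q : map sigma (wpow u q) = wpow (map sigma u) q.
  by elim: q => // q IH; rewrite /wpow /= map_cat -/(wpow u q) IH.
rewrite /zig !map_cat !sw map_cat sigma_zigA sigma_zigB; congr (_ ++ _).
by rewrite sigma_Dword //= subn0 subn1.
Qed.

Lemma inord_forall (P : I -> Prop) : (forall k, k < n.+3 -> P (inord k)) -> forall i, P i.
Proof. by move=> H i; rewrite -[i]inord_val; exact: H. Qed.

(** * Irreducible words with a zigzag pattern are zigzags *)

Lemma tight_equiv f g u v : spread m u -> lirr m u -> lirr m (rev u) ->
  (forall i, i \in u) -> (forall i, 2 - pre i u = f i) -> run m f v g ->
  (forall k, k < n.+3 -> cn u k = cn v k) -> comm_equiv m u v.
Proof.
move=> U L R full uf [vf _] uv.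
apply: (paced_equiv Dtilde_sym Dtilde_offdiag (f := f)) => //; last exact: eq_cn_perm.
by move=> p i q E; rewrite -uf; exact: tight_paced U L R full _ _ _ E.
Qed.

(** The classification also applies to the reversed word: [zig_candy_absurd] excludes a candy
    pattern there, and otherwise [zig_count] gives the same letter counts as a zigzag. *)
Lemma tight_zig_left u : spread m u -> lirr m u -> lirr m (rev u) ->
  (forall i, i \in u) -> (forall k, k < n.+3 -> pr u k = zig_left k) ->
  exists p h, [/\ h <= 1, 0 < p + h & comm_equiv m u (zig p h)].
Proof.
move=> U L R full uE; have eqn := tight_count U L R full.
have c0 k : k < n.+3 -> 0 < cn u k by rewrite count_mem_gt0.
have R' : lirr m (rev (rev u)) by rewrite revK.
have full' i : i \in rev u by rewrite mem_rev.
have [p [h [h1 ph cE]]] : exists p h, [/\ h <= 1, 0 < p + h &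
    forall l, l < n.+3 -> cn u l = (l <= 1) + p * ((2 <= l) + (l <= n)) + h * (2 <= l)].
  case: (tight_classify (spread_rev U) R R' full') => [aE|aE|[nn [x [y [x1 yn aE]]]]].
  - by apply: (zig_count eqn) => //; left.
  - by apply: (zig_count eqn) => //; right.
  - by case: (zig_candy_absurd eqn _ x1 yn aE); rewrite !uE.
exists p, h; split=> //; apply: (tight_equiv U L R full _ (run_zig p h1)) => [|k kn].
  by apply: inord_forall => k kn; rewrite -/(pr u k) uE // inordK.
by rewrite cE // cn_zig.
Qed.

Lemma tight_zig_right u : spread m u -> lirr m u -> lirr m (rev u) ->
  (forall i, i \in u) -> (forall k, k < n.+3 -> pr u k = zig_right k) ->
  exists p h, [/\ h <= 1, 0 < p + h & comm_equiv m u (map sigma (zig p h))].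
Proof.
move=> U L R full uE.
have uE' i : pre i u = zig_right i.
  by move: i; apply: inord_forall => k kn; rewrite -/(pr u k) uE // inordK.
have [] := @tight_zig_left (map sigma u).
- exact: spread_map sigmaK sigma_m _ U.
- exact: lirr_map sigmaK sigma_m _ L.
- by rewrite -map_rev; exact: lirr_map sigmaK sigma_m _ R.
- by move=> i; rewrite -[i]sigmaK (mem_map_sigma sigmaK).
- move=> k kn; rewrite /pr -[inord k]sigmaK (pre_map sigmaK sigma_m) uE' zig_left_sigma.
  by rewrite inordK.
move=> p [h [h1 ph uz]]; exists p, h; split=> //.
by have := comm_equiv_map sigma_m uz; rewrite (mapK sigmaK).
Qed.

(** * Candy words *)

Section Candy.
Hypothesis n_even : ~~ odd n.

(** For [n] even, the inner values alternate between 2 and 0, with 2 at both inner ends. This shows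
    that the layers are antichains and that candies are star irreducible. *)
Lemma candy_pre_nbrs x y k l : x <= 1 -> n < y -> k < n.+3 -> l \in nbrs k ->
  (candy_pre x y k == 0 -> candy_pre x y l = 2) /\
  (candy_pre x y k == 2 -> candy_pre x y l != 2).
Proof.
move=> x1 ny kn lk; have ln := nbrs_lt lk.
have [k1|k1] := leqP k 1.
  move: lk; rewrite nbrs_left // inE => /eqP->.
  by rewrite candy_pre_left // candy_pre_inner ?n_ge2 //; case: (k == x).
have [nk|nk] := ltnP n k.
  move: lk; rewrite nbrs_right // inE => /eqP->.
  by rewrite candy_pre_right // candy_pre_inner ?n_ge2 ?leqnn // n_even; case: (k == y).
rewrite (candy_pre_inner x1 ny (k := k)) ?k1 //.
have [l1|l1] := leqP l 1.
  have k2 : k = 2 by move: (nbrsC kn lk); rewrite nbrs_left // inE => /eqP.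
  by rewrite (candy_pre_left _ ny l1) k2; case: (l == x).
have [nl|nl] := ltnP n l.
  have k2 : k = n by move: (nbrsC kn lk); rewrite nbrs_right // inE => /eqP.
  by rewrite (candy_pre_right _ x1 nl) k2 n_even; case: (l == y).
rewrite candy_pre_inner ?l1 //.
have -> : odd l = ~~ odd k.
  move: lk; rewrite mem_nbrs_inner ?k1 //.
  by case/orP; case: eqP => _ lk; lia.
by case: odd.
Qed.

Definition evens : {set I} := [set j : I | ~~ odd j & 2 <= j <= n].
Definition odds (a b : I) : {set I} :=
  [set j : I | odd j & 3 <= j <= n.-1] :|: [set a; b].

Lemma mem_odds (a b i : I) : a <= 1 -> n < b ->
  (i \in odds a b) = (candy_pre a b i == 0).
Proof.
move=> a1 nb; rewrite !inE -!val_eqE /=; have iE := ltn_ord i.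
have [i1|i1] := leqP i 1.
  by rewrite candy_pre_left //; case: eqP; lia.
have [ni|ni] := ltnP n i.
  by rewrite candy_pre_right //; case: eqP; lia.
by rewrite candy_pre_inner ?i1 //; apply/idP/idP; lia.
Qed.

Lemma mem_evens (a b i : I) : a <= 1 -> n < b ->
  (i \in evens) = (candy_pre a b i == 2).
Proof.
move=> a1 nb; rewrite !inE /=; have iE := ltn_ord i.
have [i1|i1] := leqP i 1.
  by rewrite candy_pre_left //; apply/idP/idP; lia.
have [ni|ni] := ltnP n i.
  by rewrite candy_pre_right //; apply/idP/idP; lia.
by rewrite candy_pre_inner ?i1 //; case: odd.
Qed.

Lemma odds_antichain (a b : I) : a <= 1 -> n < b ->
  {in enum (odds a b) &, forall s t, ~~ adj s t}.
Proof.
move=> a1 nb s t; rewrite !mem_enum !mem_odds // => s0 t0; rewrite adjE; apply/negP => st.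
by have [/(_ s0)] := candy_pre_nbrs a1 nb (ltn_ord s) st; rewrite (eqP t0).
Qed.

Lemma evens_antichain : {in enum evens &, forall s t, ~~ adj s t}.
Proof.
(* An arbitrary choice of leaves, only to describe [evens] through [candy_pre]. *)
pose a : I := inord 0; pose b : I := inord n.+1.
have a1 : a <= 1 by rewrite inordK.
have nb : n < b by rewrite inordK.
move=> s t; rewrite !mem_enum !(mem_evens _ a1 nb) => s2 t2; rewrite adjE; apply/negP => st.
by have [_ /(_ s2)] := candy_pre_nbrs a1 nb (ltn_ord s) st; rewrite t2.
Qed.

Lemma count_candy (a b : nat) k : a <= 1 -> n < b < n.+3 -> k < n.+3 ->
  \sum_(l <- nbrs k) (candy_pre a b l == 0) = if candy_pre a b k == 2 then 2 else 0.
Proof.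
move=> a1 /andP[nb bn] kn; have in2 k' : 2 <= k' <= n -> candy_pre a b k' = 2 * ~~ odd k'.
  exact: candy_pre_inner.
have [k1|k1] := leqP k 1.
  by rewrite sum_nbrs_left // (candy_pre_left _ nb k1) in2 //; case: (k == a).
have [nk|nk] := ltnP n k.
  rewrite sum_nbrs_right // (candy_pre_right _ a1 nk) in2 ?n_ge2 ?leqnn // n_even.
  by case: (k == b).
pose z l : nat := candy_pre a b l == 0.
have z1 : fold_leaves z 1 = 1.
  rewrite fold_leaves_left /z !candy_pre_left //.
  by case: (a) a1 => [|[|]].
have zn : fold_leaves z n.+1 = 1.
  by rewrite fold_leaves_right /z !candy_pre_right //; lia.
have zin l : 2 <= l <= n -> fold_leaves z l = odd l.
  by move=> ln; rewrite fold_leaves_inner // /z in2 //; case: odd.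
have zE l : 1 <= l <= n.+1 -> fold_leaves z l = odd l.
  move=> ln; have [->|l1] := eqVneq l 1; first by rewrite z1.
  have [->|l2] := eqVneq l n.+1; first by rewrite zn /= n_even.
  by apply: zin; lia.
rewrite -/z sum_nbrs_inner ?k1 // !zE; [|lia|lia].
rewrite in2 ?k1 // (_ : odd k.-1 = ~~ odd k) /=; last by lia.
by case: odd.
Qed.

Lemma count_evens (a b : nat) k : a <= 1 -> n < b < n.+3 -> k < n.+3 ->
  \sum_(l <- nbrs k) (candy_pre a b l == 2) =
  if (k <= 1) || (n < k) then 1 else 2 * odd k.
Proof.
move=> a1 /andP[nb bn] kn; have in2 k' : 2 <= k' <= n -> candy_pre a b k' = 2 * ~~ odd k'.
  exact: candy_pre_inner.
have [k1|k1] := leqP k 1.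
  by rewrite sum_nbrs_left // in2.
have [nk|nk] := ltnP n k.
  by rewrite sum_nbrs_right // in2 ?n_ge2 ?leqnn // n_even.
pose z l : nat := candy_pre a b l == 2.
have z1 : fold_leaves z 1 = 0.
  by rewrite fold_leaves_left /z !candy_pre_left //; lia.
have zn : fold_leaves z n.+1 = 0.
  by rewrite fold_leaves_right /z !candy_pre_right //; lia.
have zin l : 2 <= l <= n -> fold_leaves z l = ~~ odd l.
  by move=> ln; rewrite fold_leaves_inner // /z in2 //; case: odd.
have zE l : 1 <= l <= n.+1 -> fold_leaves z l = ~~ odd l.
  move=> ln; have [->|l1] := eqVneq l 1; first by rewrite z1.
  have [->|l2] := eqVneq l n.+1; first by rewrite zn /= n_even.
  by apply: zin; lia.
rewrite -/z sum_nbrs_inner ?k1 // !zE; [|lia|lia].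
rewrite (_ : odd k.-1 = ~~ odd k) /=; last by lia.
by case: odd.
Qed.

Lemma nbc_enum (S : {set I}) (P : nat -> bool) k : (forall i, (i \in S) = P i) ->
  k < n.+3 -> nbc (inord k) (enum S) = \sum_(l <- nbrs k) P l.
Proof.
move=> SP; apply: nbc_counts => l ln.
by rewrite /cn count_uniq_mem ?enum_uniq // mem_enum SP inordK.
Qed.

Lemma run_odds (a b : I) : a <= 1 -> n < b ->
  run m (fun i => 2 - candy_pre a b i) (enum (odds a b)) (fun i => candy_pre a b i).
Proof.
move=> a1 nb; have bn := ltn_ord b; have sE i := mem_odds i a1 nb.
apply: run_antichain => [|||].
- exact: enum_uniq.
- exact: odds_antichain.
- by move=> s; rewrite mem_enum sE => /eqP->.
apply: inord_forall => k kn.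
rewrite (nbc_enum (P := fun l => candy_pre a b l == 0) sE kn) mem_enum sE inordK //.
rewrite count_candy ?nb //.
by rewrite /candy_pre; repeat case: ifP => _.
Qed.

(** Every leaf gains 1 from 2 or [n]: the leaf read before goes to 1 and its twin to 2, so the next
    layer has to use the other leaf at each end. *)
Lemma run_evens (a b a' b' : I) : a <= 1 -> n < b -> a' <= 1 -> n < b' ->
  a != a' -> b != b' ->
  run m (fun i => candy_pre a b i) (enum evens) (fun i => 2 - candy_pre a' b' i).
Proof.
move=> a1 nb a1' nb' aa bb; have bn := ltn_ord b; have bn' := ltn_ord b'.
have sE i := mem_evens i a1 nb.
apply: run_antichain => [|||].
- exact: enum_uniq.
- exact: evens_antichain.
- by move=> s; rewrite mem_enum sE => /eqP->.
apply: inord_forall => k kn.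
rewrite (nbc_enum (P := fun l => candy_pre a b l == 2) sE kn) mem_enum sE inordK //.
rewrite count_evens ?nb //; rewrite -!val_eqE /= in aa bb.
have [k1|k1] := leqP k 1.
  by rewrite !candy_pre_left //=; lia.
have [nk|nk] := ltnP n k.
  by rewrite !candy_pre_right //=; lia.
by rewrite !candy_pre_inner ?k1 //; case: odd.
Qed.

Definition layer (x y : nat -> I) k := if odd k then evens else odds (x k./2) (y k./2).

(** The last index of the normal form is [t.*2], so [t] is the number of layers [evens]. *)
Definition candy (x y : nat -> I) (t : nat) : seq I :=
  flatten [seq enum (layer x y k) | k <- iota 0 t.*2.+1].

Definition candy_ends (x y : nat -> I) (t : nat) :=
  (forall k, k <= t -> x k <= 1 /\ n < y k) /\
  (forall k, k < t -> x k != x k.+1 /\ y k != y k.+1).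

Lemma candyS (x y : nat -> I) (t : nat) : candy x y t.+1 =
  candy x y t ++ enum evens ++ enum (odds (x t.+1) (y t.+1)).
Proof.
have E : iota 0 t.+1.*2.+1 = iota 0 t.*2.+1 ++ [:: t.*2.+1; t.*2.+2].
  by rewrite doubleS -(addn2 t.*2.+1) iotaD.
rewrite /candy E map_cat flatten_cat; congr (_ ++ _).
by rewrite /= cats0 /layer /= odd_double doubleK.
Qed.

Lemma candy0 (x y : nat -> I) : candy x y 0 = enum (odds (x 0) (y 0)).
Proof. by rewrite /candy /= cats0. Qed.

Lemma candy_endsW (x y : nat -> I) (t : nat) : candy_ends x y t.+1 -> candy_ends x y t.
Proof. by move=> [H1 H2]; split=> k kt; [apply: H1|apply: H2]; exact: leqW. Qed.

Lemma run_candy (x y : nat -> I) (t : nat) : candy_ends x y t ->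
  run m (fun i => 2 - candy_pre (x 0) (y 0) i) (candy x y t)
        (fun i => candy_pre (x t) (y t) i).
Proof.
elim: t => [|t IH] H; first by have [/(_ 0 isT)[? ?] _] := H; rewrite candy0; exact: run_odds.
have [H1 H2] := H; have [xt yt] := H1 t (leqnSn t); have [xt' yt'] := H1 t.+1 (leqnn _).
have [dx dy] := H2 t (ltnSn t); rewrite candyS; apply: run_cat (IH (candy_endsW H)) _.
apply: run_cat (run_evens xt yt xt' yt' dx dy) _; exact: run_odds.
Qed.

Lemma cn_candy2 (x y : nat -> I) (t : nat) : candy_ends x y t -> cn (candy x y t) 2 = t.
Proof.
have c0 (a b : I) : a <= 1 -> n < b -> cn (enum (odds a b)) 2 = 0.
  move=> a1 nb; rewrite /cn count_uniq_mem ?enum_uniq // mem_enum mem_odds //.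
  by rewrite inordK // candy_pre_inner.
have c1 : cn (enum evens) 2 = 1.
  by rewrite /cn count_uniq_mem ?enum_uniq // mem_enum inE inordK // n_ge2.
elim: t => [|t IH] H; have [H1 H2] := H.
  by rewrite candy0 c0; have [] := H1 0 isT.
have [xt yt] := H1 t.+1 (leqnn _).
rewrite candyS (cn_cat (candy x y t)) (cn_cat (enum evens)) c0 // c1.
by rewrite (IH (candy_endsW H)); lia.
Qed.

Lemma candy_full (x y : nat -> I) (t : nat) : candy_ends x y t -> 0 < t ->
  forall i, i \in candy x y t.
Proof.
case: t => // t H _ i.
have : i \in candy x y 1.
  have [H1 H2] := H; have [x0 y0] := H1 0 isT; have [x1 y1] := H1 1 isT.
  have [dx dy] := H2 0 isT; rewrite -!val_eqE /= in dx dy.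
  rewrite candyS candy0 !mem_cat !mem_enum (mem_evens i x0 y0) !mem_odds //.
  have iE := ltn_ord i; have yE := ltn_ord (y 0); have yE' := ltn_ord (y 1).
  have [i1|i1] := leqP i 1.
    by rewrite !candy_pre_left //; do 2!case: eqP; lia.
  have [ni|ni] := ltnP n i.
    by rewrite !candy_pre_right //; do 2!case: eqP; lia.
  by rewrite !candy_pre_inner ?i1 //; case: odd.
elim: t {H} => // t IH /IH it; rewrite (candyS _ _ t.+1).
by rewrite (mem_cat i (candy x y t.+1)) it.
Qed.

Lemma lirr_candy (a b : nat) u : a <= 1 -> n < b ->
  (forall i, pre i u = candy_pre a b i) -> lirr m u.
Proof.
move=> a1 nb uE s t _ _; rewrite !uE adjE => /eqP s0 t1; apply/negP => st.
by have [/(_ s0)] := candy_pre_nbrs a1 nb (ltn_ord s) st; rewrite t1.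
Qed.

Lemma candy_pre_le2 a b k : candy_pre a b k <= 2.
Proof. by rewrite /candy_pre; repeat case: ifP => _. Qed.

Lemma pre_candy (x y : nat -> I) (t : nat) : candy_ends x y t -> 0 < t ->
  (forall i, pre i (candy x y t) = candy_pre (x 0) (y 0) i) /\
  (forall i, pre i (rev (candy x y t)) = candy_pre (x t) (y t) i).
Proof.
move=> H t0; have rc := run_candy H; split=> i.
  by rewrite (run_pre rc) ?candy_full // subKn // candy_pre_le2.
by rewrite (run_pre_rev Dtilde_diag rc) ?candy_full.
Qed.

Lemma candy_lirr (x y : nat -> I) (t : nat) : candy_ends x y t -> 0 < t ->
  lirr m (candy x y t) /\ lirr m (rev (candy x y t)).
Proof.
move=> H t0; have [E1 E2] := pre_candy H t0; have [H1 _] := H.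
have [x0 y0] := H1 0 (leq0n t); have [xt yt] := H1 t (leqnn t).
by split; [exact: lirr_candy x0 y0 E1|exact: lirr_candy xt yt E2].
Qed.

Lemma candy_eqn x y (t : nat) : candy_ends x y t -> 0 < t -> forall k, k < n.+3 ->
  \sum_(l <- nbrs k) cn (candy x y t) l + 2 =
  2 * cn (candy x y t) k + candy_pre (x 0) (y 0) k + candy_pre (x t) (y t) k.
Proof.
move=> H t0 k kn; have [_ /(_ (inord k))] := run_candy H; rewrite nbc_nbrs //.
rewrite -/(cn _ k) inordK //; have := candy_pre_le2 (x 0) (y 0) k; lia.
Qed.

Lemma tight_candy u x y : spread m u -> lirr m u -> lirr m (rev u) ->
  (forall i, i \in u) -> x <= 1 -> n < y < n.+3 ->
  (forall k, k < n.+3 -> pr u k = candy_pre x y k) ->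
  exists X Y (t : nat), [/\ candy_ends X Y t, 0 < t & comm_equiv m u (candy X Y t)].
Proof.
move=> U L R full x1 yn uE; have eqn := tight_count U L R full.
have R' : lirr m (rev (rev u)) by rewrite revK.
have full' i : i \in rev u by rewrite mem_rev.
have eqn' k : k < n.+3 ->
    \sum_(l <- nbrs k) cn u l + 2 = 2 * cn u k + pr (rev u) k + pr u k.
  by move=> kn; rewrite eqn // addnAC.
have [x' [y' [x1' yn' aE]]] : exists x' y', [/\ x' <= 1, n < y' < n.+3 &
    forall k, k < n.+3 -> pr (rev u) k = candy_pre x' y' k].
  (* A zigzag at the far end is excluded by [zig_candy_absurd] with the two ends exchanged. *)
  case: (tight_classify (spread_rev U) R R' full') => [aE|aE|[_ //]];
    by case: (zig_candy_absurd eqn' _ x1 yn uE); rewrite !aE // /zig_right !zig_left_ge2; lia.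
have [yl yr] := andP yn.
pose t := cn u 2; have t0 : 0 < t by rewrite count_mem_gt0.
(* The leaves alternate: [1 - x] exchanges 0 and 1, and [n.*2.+3 - y] exchanges [n.+1] and
   [n.+2]. *)
pose X k : I := inord (if odd k then 1 - x else x).
pose Y k : I := inord (if odd k then n.*2.+3 - y else y).
have XE k : X k = (if odd k then 1 - x else x) :> nat by rewrite inordK //; case: ifP; lia.
have YE k : Y k = (if odd k then n.*2.+3 - y else y) :> nat.
  by rewrite inordK //; case: ifP; lia.
have ends : candy_ends X Y t.
  split=> k _; first by rewrite XE YE; case: ifP; lia.
  by rewrite -!val_eqE /= XE YE !XE !YE /=; case: (odd k) => /=; lia.
have X0 : X 0 = x :> nat by rewrite XE.
have Y0 : Y 0 = y :> nat by rewrite YE.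
have [Xt Yt] : X t <= 1 /\ n < Y t by case: ends => /(_ t (leqnn t)).
exists X, Y, t; split=> //; apply: (tight_equiv U L R full _ (run_candy ends)) => [|k kn].
  by apply: inord_forall => k kn; rewrite -/(pr u k) uE // X0 Y0 inordK.
have [in_u l_u r_u] := candy_count eqn n_even x1 yn x1' yn' uE aE.
have eqnK := candy_eqn ends t0; rewrite X0 Y0 in eqnK.
have [in_K l_K r_K] := candy_count eqnK n_even x1 yn Xt
  (introT andP (conj Yt (ltn_ord (Y t)))) (fun _ _ => erefl) (fun _ _ => erefl).
rewrite (cn_candy2 ends) in in_K l_K r_K.
(* The final leaves [x'], [y'] need not be compared with those of the candy: the doubled leaf counts
   of the two words differ by at most 1, hence agree. *)
have [k1|k1] := leqP k 1; first by have := l_u k k1; have := l_K k k1; rewrite -/t; lia.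
have [nk|nk] := ltnP n k; last by rewrite in_u ?in_K ?k1.
by have := r_u k; have := r_K k; rewrite nk kn -/t; lia.
Qed.

End Candy.

Lemma pre_zig p h i : h <= 1 -> 0 < p + h -> pre i (zig p h) = zig_left i.
Proof.
move=> h1 ph; rewrite (run_pre (run_zig p h1)) ?zig_full // subKn //.
by rewrite /zig_left; do ?case: ifP.
Qed.

(** The link condition of the normal form: leaves are linked to 2 or [n], an inner odd [s] to
    [s.-1]. *)
Lemma odds_link (a b s : I) : ~~ odd n -> a <= 1 -> n < b -> s \in odds a b ->
  exists2 s', s' \in enum evens & adj s' s.
Proof.
move=> nn a1 nb; rewrite mem_odds // => s0; have sn := ltn_ord s.
have link k : k < n.+3 -> ~~ odd k -> 2 <= k <= n -> val s \in nbrs k ->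
    exists2 s', s' \in enum evens & adj s' s.
  move=> kn ok kin sk; exists (inord k); last by rewrite adjE inordK.
  by rewrite mem_enum inE inordK // ok.
have [s1|s1] := leqP s 1.
  have s2 : val s \in nbrs 2 by apply: nbrsC => //; rewrite nbrs_left.
  by apply: link s2; rewrite ?n_ge2.
have [ns|ns] := ltnP n s.
  have sn' : val s \in nbrs n by apply: nbrsC => //; rewrite nbrs_right ?inE.
  by apply: link sn'; rewrite ?n_ge2 ?leqnn //; lia.
have os : odd s by move: s0; rewrite candy_pre_inner ?s1 //; case: odd.
have s3 : 2 < s by rewrite ltn_neqAle s1 andbT; apply: contraTneq os => <-.
have sp : val s \in nbrs s.-1.
  by apply: nbrsC => //; rewrite mem_nbrs_inner ?s1 // gtn_eqF ?eqxx.
by apply: link sp; lia.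
Qed.

(** The link condition for the other layers: [n] is linked to the leaf [b], a smaller even [s] to
    [s.+1]. *)
Lemma evens_link (a b s : I) : ~~ odd n -> a <= 1 -> n < b -> s \in evens ->
  exists2 s', s' \in enum (odds a b) & adj s' s.
Proof.
move=> nn a1 nb; rewrite inE => /andP[os sn]; have bn := ltn_ord b.
have [sE|sE] := eqVneq (s : nat) n.
  exists b; first by rewrite mem_enum !inE eqxx !orbT.
  by rewrite adjE nbrs_right // inE; apply/eqP.
exists (inord s.+1).
  by rewrite mem_enum !inE inordK /=; lia.
rewrite (adjC Dtilde_sym) adjE /= inordK; last by lia.
by rewrite mem_nbrs_inner // (negPf sE) eqxx orbT.
Qed.

(** * From words back to elements of the group *)

Section Group.
Variable W : coxeterSystem m.
Implicit Types w : W.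
Local Notation wprod := (wprod W).
Local Notation FC_irreducibleP :=
  (star_irreducibleP Dtilde_diag Dtilde_sym Dtilde_offdiag).

Lemma CZP w : CZ W w <-> FC W w /\ exists p h, [/\ h <= 1, 0 < p + h &
  reduced_expr (zig p h) w \/ reduced_expr (map sigma (zig p h)) w].
Proof.
by split=> -[fc [p [h [h1 ph H]]]]; split=> //; exists p, h; split=> //;
  move: H; rewrite sigma_zig.
Qed.

Lemma candies_expr w : candies W w -> [/\ ~~ odd n, FC W w &
  exists x y (t : nat), [/\ candy_ends x y t, 0 < t & reduced_expr (candy x y t) w]].
Proof.
move=> [nn fc [us [p [x [y [[us_sz cfnf] p2 pe evenP oddP]]]]]]; split=> //.
have pE : p = (p./2).*2 by rewrite -[LHS]odd_double_half (negbTE pe).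
exists x, y, p./2; split; [split|by lia|].
- move=> k kp; have [] := evenP k kp; rewrite !inE => xk yk _.
  by split; [case/orP: xk => /eqP->|case/orP: yk => /eqP->].
- by move=> k kp; have [] := oddP k kp.
have := CFNF_expr Dtilde_diag Dtilde_sym Dtilde_offdiag cfnf.
rewrite /candy (_ : [seq _ | _ <- us] =
  [seq enum (layer x y k) | k <- iota 0 (p./2).*2.+1]) //.
apply: (@eq_from_nth _ [::]) => [|k]; rewrite !size_map ?size_iota -?pE // us_sz => kp.
rewrite (nth_map 1%g) ?us_sz // (nth_map 0) ?size_iota // nth_iota // add0n.
congr (enum _); rewrite /layer -[in LHS](odd_double_half k).
case: (boolP (odd k)) => ok /=; rewrite ?add1n ?add0n.
  by have [|_ _ ->] := oddP k./2; first by lia.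
by have [|_ _ ->] := evenP k./2; first by lia.
Qed.

Lemma candies_intro w x y (t : nat) : ~~ odd n -> FC W w ->
  candy_ends x y t -> 0 < t -> reduced_expr (candy x y t) w -> candies W w.
Proof.
move=> nn fc ends t0 red; split=> //.
have [H1 H2] := ends; have [x0 y0] := H1 0 (leq0n t).
pose ls := [seq enum (layer x y k) | k <- iota 0 t.*2.+1].
have nthE k : k <= t.*2 -> nth [::] ls k = enum (layer x y k).
  by move=> kt; rewrite (nth_map 0) ?size_iota // nth_iota.
have anti k : k <= t.*2 -> {in enum (layer x y k) &, forall s t, ~~ adj s t}.
  move=> kt; rewrite /layer; case: ifP => _; first exact: evens_antichain.
  have [|xk yk] := H1 k./2; first by lia.
  exact: odds_antichain.
have cfnf : is_CFNF [seq wprod z | z <- ls] w.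
  apply: (CFNF_intro Dtilde_diag Dtilde_sym Dtilde_offdiag fc red).
  - move=> z /mapP[k]; rewrite mem_iota add0n => kt ->.
    by split; [exact: enum_uniq|exact: anti].
  - move=> s; rewrite nthE // mem_enum /src candy_full // mem_odds //.
    by have [-> _] := pre_candy nn ends t0.
  move=> k; rewrite size_map size_iota ltnS => kt s.
  rewrite !nthE //; last by lia.
  rewrite !mem_enum /layer /=; case: (boolP (odd k)) => ok /=.
    have [|xk yk] := H1 (uphalf k); first by lia.
    exact: odds_link.
  have [|xk yk] := H1 k./2; first by lia.
  exact: evens_link.
exists [seq wprod z | z <- ls], t.*2, x, y; split=> //.
- by split=> //; rewrite !size_map size_iota.
- by lia.
- by rewrite odd_double.
- move=> i; rewrite doubleK => it; have [xi yi] := H1 i it; split.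
  + by rewrite !inE /=; lia.
  + by have := ltn_ord (y i); rewrite !inE /=; lia.
  have it2 : i.*2 <= t.*2 by lia.
  have lt : i.*2 < size ls by rewrite size_map size_iota.
  apply/setP => s; rewrite (nth_map [::]) // nthE //.
  rewrite (antichain_supp Dtilde_diag Dtilde_sym Dtilde_offdiag) ?enum_uniq ?mem_enum //.
    by rewrite /layer odd_double doubleK.
  exact: anti.
- move=> i; rewrite doubleK => it; have [dx dy] := H2 i it; split=> //.
  have it2 : i.*2.+1 <= t.*2 by lia.
  have lt : i.*2.+1 < size ls by rewrite size_map size_iota.
  apply/setP => s; rewrite (nth_map [::]) // nthE //.
  rewrite (antichain_supp Dtilde_diag Dtilde_sym Dtilde_offdiag) ?enum_uniq ?mem_enum //.
    by rewrite /layer /= odd_double.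
  exact: anti.
Qed.

Lemma CC_not_full w u : FC W w -> reduced_expr u w -> (forall i, i \in u) -> ~ CC W w.
Proof.
move=> fc red full cc.
have := CC_nadj Dtilde_diag Dtilde_sym Dtilde_offdiag cc red (full (inord 0)) (full (inord 2)).
by rewrite adj_inord.
Qed.

Lemma map_sigma_full u : (forall i, i \in u) -> forall i, i \in map sigma u.
Proof. by move=> full i; rewrite -[i]sigmaK (mem_map_sigma sigmaK). Qed.

(** The initial pattern depends only on [w]: a zigzag starts with both leaves of one end, a candy
    with exactly one leaf at each end. *)
Lemma candies_CZ w : candies W w -> ~ CZ W w.
Proof.
move=> /candies_expr[nn fc [x [y [t [ends t0 red]]]]] /CZP[_ [p [h [h1 ph H]]]].
have [preE _] := pre_candy nn ends t0; have [/(_ 0 isT)[x0 y0] _] := ends.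
have yE := ltn_ord (y 0).
have eqP v : reduced_expr v w -> forall i, pre i v = candy_pre (x 0) (y 0) i.
  move=> rv i; rewrite -preE; apply: (comm_equiv_pre Dtilde_diag Dtilde_sym); exact: fc.
case: H => /eqP H.
  have := H (inord 0); have := H (inord 1).
  by rewrite !pre_zig // !inordK // !candy_pre_left // !zig_left_le1 //; lia.
have E k : k < n.+3 -> zig_left k = candy_pre (x 0) (y 0) (n.+2 - k).
  move=> kn; have := H (inord (n.+2 - k)); rewrite -sigma_inord //.
  rewrite (pre_map sigmaK sigma_m) pre_zig // sigma_inord // !inordK //; lia.
have := E 0; have := E 1.
by rewrite !zig_left_le1 // !candy_pre_right //; lia.
Qed.

(** A reduced word is an antichain or has full support; in the latter case its initial pattern
    decides between zigzags and candies. *)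
Lemma star_irreducible_cases w :
  star_irreducible W w -> candies W w \/ CZ W w \/ CC W w.
Proof.
move=> irr; have [fc _] := irr; have [u red] := reduced_exists w.
have U := FC_spread Dtilde_diag Dtilde_sym Dtilde_offdiag fc red.
have [L R] := iffLR (FC_irreducibleP fc red) irr.
have [[Uu Nu]|full] := support_dichotomy U L R.
  right; right; apply/(CCP Dtilde_diag Dtilde_sym Dtilde_offdiag).
  by exists u; split=> //; case: red.
have to_red v : comm_equiv m u v -> reduced_expr v w.
  by move=> uv; exact: comm_equiv_reduced Dtilde_diag _ _ _ _ uv red.
case: (tight_classify U L R full) => [uE|uE|[nn [x [y [x1 yn uE]]]]].
- have [p [h [h1 ph /to_red rz]]] := tight_zig_left U L R full uE.
  by right; left; apply/CZP; split=> //; exists p, h; split=> //; left.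
- have [p [h [h1 ph /to_red rz]]] := tight_zig_right U L R full uE.
  by right; left; apply/CZP; split=> //; exists p, h; split=> //; right.
- have [X [Y [t [ends t0 /to_red rc]]]] := tight_candy nn U L R full x1 yn uE.
  by left; exact: candies_intro nn fc ends t0 rc.
Qed.

Lemma candies_irreducible w : candies W w -> star_irreducible W w.
Proof.
move=> /candies_expr[nn fc [x [y [t [ends t0 red]]]]].
by apply/(FC_irreducibleP fc red); exact: candy_lirr.
Qed.

Lemma CZ_irreducible w : CZ W w -> star_irreducible W w.
Proof.
move=> /CZP[fc [p [h [h1 ph H]]]]; have [L R] := zig_lirr h1 ph.
case: H => red; apply/(FC_irreducibleP fc red); first by split.
by rewrite -map_rev; split; exact: lirr_map sigmaK sigma_m _ _.
Qed.

Lemma candies_CC w : candies W w -> ~ CC W w.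
Proof.
move=> /candies_expr[nn fc [x [y [t [ends t0 red]]]]].
by apply: CC_not_full fc red _; exact: candy_full.
Qed.

Lemma CZ_CC w : CZ W w -> ~ CC W w.
Proof.
move=> /CZP[fc [p [h [h1 ph [red|red]]]]]; apply: CC_not_full fc red _.
  by move=> i; exact: zig_full.
by apply: map_sigma_full => i; exact: zig_full.
Qed.

End Group.

End DtildeWords.

(** * The decomposition into three disjoint sets *)

Local Open Scope classical_set_scope.

Theorem theorem2p20 (n : nat) (hn : 2 <= n)
    (W : coxeterSystem (Dtilde n)) :
  [/\ star_irreducible W = candies W `|` CZ W `|` CC W,
      candies W `&` CZ W = set0,
      candies W `&` CC W = set0,
      CZ W `&` CC W = set0 &
      odd n -> candies W = set0].
Proof.
split.
- apply/seteqP; split=> w.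
    by case/(star_irreducible_cases hn) => [|[|]] H; [left; left|left; right|right].
  move=> [[/(candies_irreducible hn)|/(CZ_irreducible hn)]|] //.
  exact: (CC_star_irreducible (@Dtilde_diag n) (@Dtilde_sym n) (@Dtilde_offdiag n)).
- by rewrite -subset0 => w [/(candies_CZ hn)].
- by rewrite -subset0 => w [/(candies_CC hn)].
- by rewrite -subset0 => w [/(CZ_CC hn)].
- by move=> on; rewrite -subset0 => w [/negP].
Qed.
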